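(* There exists a pentagonal geometry $\mathrm{PENT}(3,r)$ with a best possible identifying code for all positive integers $r \equiv 0$ or $1 \pmod 3$ except $r \in \{1, 4, 6, 7\}$ (for which no such geometry exists).
   Context: A partial linear space is a (finite) set of points together with a set of lines, each line identified with the set of points incident with it, such that two distinct points lie on at most one common line. Two points are collinear if some line contains both (so a point that lies on a line is collinear with itself). A pentagonal geometry $\mathrm{PENT}(k,r)$ is a partial linear space in which every line has exactly $k$ points, every point is on exactly $r$ lines, and for every point $x$ the set of points not collinear with $x$ is (the point set of) a line of the geometry. Its deficiency graph has the points of the geometry as vertices, with $x \sim y$ precisely when $x$ and $y$ are not collinear; it is $k$-regular with $(k-1)r + k + 1$ vertices. For a graph $G$, $N(x)$ denotes the (open) set of neighbours of $x$. A set $S \subseteq V(G)$ is an identifying code for $G$ if the sets $N(x) \cap S$, $x \in V(G)$, are pairwise distinct. An identifying code $S$ for a $w$-regular graph with $v$ vertices is best possible if $|S| = \left\lceil 2(v-1)/(w+1) \right\rceil$. A (best possible) identifying code for a geometry is a (best possible) identifying code for its deficiency graph. *)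

(* Defs.v *)
From mathcomp Require Import all_boot all_order all_algebra.
Set Implicit Arguments.
Unset Strict Implicit.
Unset Printing Implicit Defensive.

(* A geometry is a finite type of points T with a set L of lines, each line
   being the set of points incident with it. *)

Definition partial_linear_space (T : finType) (L : {set {set T}}) : Prop :=
  forall x y : T, x != y ->
  forall l m : {set T}, l \in L -> m \in L ->
    x \in l -> y \in l -> x \in m -> y \in m -> l = m.

Definition collinear (T : finType) (L : {set {set T}}) : rel T :=
  fun x y => [exists l in L, (x \in l) && (y \in l)].

(* Nonemptiness is required because the geometry with no points and no lines
   would otherwise satisfy the remaining clauses vacuously for all k and r;
   a PENT(k, r) has (k - 1) * r + k + 1 points. *)
Record pentagonal_geometry (k r : nat) (T : finType) (L : {set {set T}}) :
    Prop := {
  pent_nonempty : 0 < #|T|;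
  pent_pls : partial_linear_space L;
  pent_line_size : forall l : {set T}, l \in L -> #|l| = k;
  pent_point_degree : forall x : T, #|[set l in L | x \in l]| = r;
  pent_opposite_line : forall x : T, [set y | ~~ collinear L x y] \in L
}.

Definition deficiency_graph (T : finType) (L : {set {set T}}) : rel T :=
  fun x y => ~~ collinear L x y.

Definition nbhd (V : finType) (e : rel V) (x : V) : {set V} := [set y | e x y].

Definition regular_graph (V : finType) (e : rel V) (w : nat) : Prop :=
  forall x : V, #|nbhd e x| = w.

Definition identifying_code (V : finType) (e : rel V) (S : {set V}) : Prop :=
  injective (fun x : V => nbhd e x :&: S).

Definition best_possible_code (V : finType) (e : rel V) (w : nat)
    (S : {set V}) : Prop :=
  [/\ regular_graph e w,
      identifying_code e S &
      #|S|%:Z%R =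
        Num.ceil (2%:R * (#|V|%:R - 1) / (w%:R + 1) : rat)%R].

Definition exists_pent_with_best_code (k r : nat) : Prop :=
  exists (T : finType) (L : {set {set T}}),
    pentagonal_geometry k r L /\
    exists S : {set T}, best_possible_code (deficiency_graph L) k S.

(* Main.v *)
(* Existence. Encode a PENT(3, r) on v = 2 r + 4 points by its deficiency graph
   and the map sending two collinear points to the third point of their line.
   Codes are required to meet every neighbourhood, so that they glue along
   disjoint unions of deficiency graphs. If g = 2 n with n odd, and w <= g is
   even, truncating the fourth group of the transversal design TD(4, n) over
   Z_n to w / 2 points and giving weight 2 yields a 3-GDD of type g^3 w^1;
   filling its groups gives v = 3 g + w. Together with finitely many cyclic
   constructions this reaches every v = 0 or 4 mod 6 other than 6, 12, 16, 18.

   Nonexistence. The deficiency graph is cubic of girth at least 5. Call a line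
   far when it is not a neighbourhood; there are v r / 3 - v far lines, r - 3
   of them through each point. If a far line meets W in s points then
   (s - 1) (s - 2) >= 0, and summing over the far lines shows that W contains at
   least (r - 3) |W| - (v r / 3 - v) pairs at distance at least 3. This
   inequality leaves only a small search over partial graphs, started from a
   pentagon if there is one and from a point otherwise. *)
Require Import Defs.
From mathcomp Require Import all_boot all_order all_algebra.
From mathcomp Require Import zify ring lra.
Set Implicit Arguments.
Unset Strict Implicit.
Unset Printing Implicit Defensive.

Import Order.TTheory GRing.Theory Num.Theory.

(** A best possible code in a cubic graph on an even number [v] of points has [v / 2] points. Half
    the points is an additive size, so best possible codes of the groups unite to a best possible
    code of the whole; this is why every piece of data carries a code of exactly this size. In the
    nonexistence part the code is used only through one consequence: distinct points have distinct
    neighbourhoods. Since neighbourhoods are lines, two points with two common neighbours would have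
    the same neighbourhood, so there are no squares. The case [r = 1] shows that this is where an
    exception can come from: two disjoint lines of three points do form a PENT(3, 1), but its
    deficiency graph is K_{3,3}, which has no identifying code. *)

(** * Finite data for a geometry with a code *)

Definition separated (nb : nat -> seq nat) (S : pred nat) (x y : nat) : bool :=
  has (fun z => S z && (z \notin nb y)) (nb x) ||
  has (fun z => S z && (z \notin nb x)) (nb y).

(** The last clause makes the neighbourhood of [x] a line: the third point of two neighbours differs
    from both by [pair_ok], hence it is the remaining neighbour. *)
Definition point_ok (v : nat) (nb : nat -> seq nat) (t : nat -> nat -> nat)
    (S : pred nat) (x : nat) : bool :=
  [&& size (nb x) == 3, uniq (nb x), x \notin nb x,
      all (fun y => (y < v) && (x \in nb y)) (nb x), has S (nb x) &
      all (fun y => all (fun z => (y != z) ==>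
        (z \notin nb y) && (t y z \in nb x)) (nb x)) (nb x)].

(** The equations [t x z = y] and [t y x = z], required for all ordered pairs, make [t] invariant
    under every permutation of the points of a line. *)
Definition pair_ok (v : nat) (nb : nat -> seq nat) (t : nat -> nat -> nat)
    (S : pred nat) (x y : nat) : bool :=
  (x != y) ==> separated nb S x y &&
    ((y \in nb x) || let z := t x y in
       [&& z < v, z != x, z \notin nb x, t x z == y & t y x == z]).

Definition pent_data (v : nat) (nb : nat -> seq nat) (t : nat -> nat -> nat)
    (S : pred nat) : Prop :=
  [/\ forall x, x < v -> point_ok v nb t S x,
      forall x y, x < v -> y < v -> pair_ok v nb t S x y &
      2 * count S (iota 0 v) = v].

Definition pent_order (v : nat) : Prop :=
  exists nb t S, pent_data v nb t S.

Lemma cards3_third (T : finType) (a b c : T) :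
  uniq [:: a; b; c] -> #|[set a; b; c]| = 3.
Proof.
rewrite /= !inE negb_or => /andP[/andP[ab ac] /andP[bc _]].
by rewrite -setUA !cardsU1 cards1 !inE negb_or ab ac bc.
Qed.

(** Each [y] other than [x] that is collinear with [x] lies on exactly one line through [x], so
    adding up the two further points of each such line counts [y] once. *)
Lemma star_card (T : finType) (L : {set {set T}}) (x : T) :
    partial_linear_space L -> (forall l, l \in L -> #|l| = 3) ->
  #|[set y | (y != x) && collinear L x y]| = 2 * #|[set l in L | x \in l]|.
Proof.
move=> pls sz3.
have card2 l : l \in [set l in L | x \in l] -> #|l :\ x| = 2.
  by rewrite inE => /andP[lL xl]; have := cardsD1 x l; rewrite xl sz3 // => -[].
rewrite mulnC -sum_nat_const -(eq_bigr _ card2).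
under eq_bigr => l _ do rewrite -sum1_card big_mkcond /=.
rewrite exchange_big /= -sum1_card big_mkcond; apply: eq_bigr => y _ /=.
rewrite -big_mkcondr inE sum1_card.
case: ifP => [/andP[yx /exists_inP[l lL /andP[xl yl]]]|/negbT].
  rewrite -(cards1 l); apply: eq_card => m.
  rewrite inE [RHS]unfold_in /= !inE yx /=.
  apply/eqP/idP => [->|/andP[/andP[mL xm] ym]]; first by rewrite lL xl.
  by apply: (pls x y); rewrite 1?eq_sym.
rewrite negb_and negbK => ncol; apply/esym/eq_card0 => m.
rewrite unfold_in /= !inE.
apply/negP => /andP[/andP[mL xm] /andP[yx ym]]; move: ncol; rewrite (negbTE yx).
by case/exists_inP; exists m; rewrite ?xm.
Qed.

(** * The geometry defined by the data *)

Section Geometry.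

Variables (v r : nat) (nb : nat -> seq nat) (t : nat -> nat -> nat).
Variable (S : pred nat).
Hypothesis data : pent_data v nb t S.
Hypotheses (r_gt0 : 0 < r) (vE : v = 2 * r + 4).

Let P := 'I_v.
Let e : rel P := fun x y => val y \in nb x.

Lemma nb_lt (x : P) y : y \in nb x -> y < v.
Proof.
case: data => /(_ _ (ltn_ord x)) /and5P[_ _ _ /allP al _] _ _ /al.
by case/andP.
Qed.

Lemma e_sym : symmetric e.
Proof.
suff imp : forall x y : P, e x y -> e y x.
  by move=> x y; apply/idP/idP => /imp.
move=> x y; case: data => /(_ _ (ltn_ord x)) /and5P[_ _ _ /allP al _] _ _ /al.
by case/andP.
Qed.

Lemma e_irr (x : P) : e x x = false.
Proof.
by case: data => /(_ _ (ltn_ord x)) /and5P[_ _ /negbTE].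
Qed.

Lemma e_card (x : P) : #|[set y | e x y]| = 3.
Proof.
case: data => /(_ _ (ltn_ord x)) /and5P[/eqP sz un _ _ _] _ _.
rewrite cardE -(size_map val) -sz; apply: perm_size; apply: uniq_perm => //.
  by rewrite map_inj_uniq ?enum_uniq //; apply: val_inj.
move=> y; apply/mapP/idP => [[z + ->]|ynb]; first by rewrite mem_enum inE.
by exists (Ordinal (nb_lt ynb)); rewrite ?mem_enum ?inE.
Qed.

(** The default [x] is not reached on distinct nonadjacent points, where [pair_ok] bounds [t x y] by
    [v]. *)
Let third (x y : P) : P := odflt x (insub (t x y)).

Lemma thirdP (x y : P) : x != y -> ~~ e x y ->
  [/\ third x y != x, ~~ e x (third x y), third x (third x y) = y &
      third y x = third x y].
Proof.
move=> xy nexy; case: data => _ /(_ _ _ (ltn_ord x) (ltn_ord y)) + _.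
rewrite /pair_ok -val_eqE /= in xy *; rewrite xy /= => /andP[_].
have /negbTE -> : val y \notin nb x by exact: nexy.
move=> /= /and5P[tv tx nex /eqP txy /eqP tyx].
have tE : val (third x y) = t x y by rewrite /third insubT.
split; first by rewrite -val_eqE tE.
- by rewrite /e tE.
- by apply: val_inj; rewrite {1}/third tE txy insubT //=.
- by apply: val_inj; rewrite {1}/third tyx insubT /= tE.
Qed.

Lemma third_neqr (x y : P) : x != y -> ~~ e x y ->
  third x y != y /\ ~~ e y (third x y).
Proof.
move=> xy nexy; have [_ _ _ <-] := thirdP xy nexy.
by case: (@thirdP y x); rewrite 1?eq_sym // e_sym.
Qed.

Definition line (x y : P) : {set P} := [set x; y; third x y].
Definition lines : {set {set P}} :=
  [set line p.1 p.2 | p in [pred p : P * P | (p.1 != p.2) && ~~ e p.1 p.2]].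

Lemma linesP (l : {set P}) :
  reflect (exists x y, [/\ x != y, ~~ e x y & l = line x y]) (l \in lines).
Proof.
apply: (iffP imsetP) => [[[x y] /andP[/= xy ne] ->]|[x [y [xy ne ->]]]].
  by exists x, y.
by exists (x, y); rewrite // inE /= xy.
Qed.

(** On [{a, b, c}] each of the six ordered pairs is nonadjacent and has the remaining point as its
    third point, so any two of the points generate the same line. *)
Lemma line_any (l : {set P}) (x y : P) : l \in lines -> x \in l -> y \in l ->
  x != y -> ~~ e x y /\ l = line x y.
Proof.
move=> /linesP[a [b [ab neab ->]]].
have [ca neac tac tba] := thirdP ab neab.
have [cb nebc] := third_neqr ab neab.
set c := third a b in ca neac tac tba cb nebc *.
have tbc : third b c = a.
  by have [] := @thirdP b a; rewrite 1?eq_sym 1?e_sym // tba.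
have tca : third c a = b.
  by have [] := @thirdP a c; rewrite 1?[a == c]eq_sym // tac.
have tcb : third c b = a.
  by have [] := @thirdP b c; rewrite 1?[b == c]eq_sym // tbc.
rewrite /line -/c !inE => /orP[/orP[]|] /eqP -> /orP[/orP[]|] /eqP ->;
  rewrite ?eqxx // => ne; split; first [by [] | by rewrite e_sym | idtac].
- by rewrite tac; apply/setP => z; rewrite !inE;
  case: (z == a); case: (z == b); case: (z == c).
- by rewrite tba; apply/setP => z; rewrite !inE; case: (z == a); case: (z == b).
- by rewrite tbc; apply/setP => z; rewrite !inE;
  case: (z == a); case: (z == b); case: (z == c).
- by rewrite tca; apply/setP => z; rewrite !inE;
  case: (z == a); case: (z == b); case: (z == c).
- by rewrite tcb; apply/setP => z; rewrite !inE;
  case: (z == a); case: (z == b); case: (z == c).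
Qed.

Lemma line_in (x y : P) : x != y -> ~~ e x y -> line x y \in lines.
Proof. by move=> xy ne; apply/linesP; exists x, y. Qed.

(** Since [v = 2 r + 4 > 4], some point is neither [x] nor one of its three neighbours. The line
    through it and [x] is what makes [x] collinear with itself. *)
Lemma exists_noncollinear (x : P) : exists y, (x != y) && ~~ e x y.
Proof.
have : 0 < #|[set y | (x != y) && ~~ e x y]|.
  have -> : [set y | (x != y) && ~~ e x y] = ~: (x |: [set y | e x y]).
    by apply/setP => y; rewrite !inE negb_or eq_sym.
  have := cardsC (x |: [set y | e x y]).
  rewrite cardsU1 inE e_irr e_card /= card_ord; move: vE #|_|; lia.
by rewrite card_gt0 => /set0Pn[y]; rewrite inE; exists y.
Qed.

Lemma collinearE (x y : P) : collinear lines x y = ~~ e x y.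
Proof.
apply/idP/idP.
  case/exists_inP => l lL /andP[xl yl]; have [->|xy] := eqVneq x y.
    by rewrite e_irr.
  by case: (line_any lL xl yl xy).
move=> ne; have [<-|xy] := eqVneq x y.
  have [z /andP[xz nez]] := exists_noncollinear x.
  apply/exists_inP; exists (line x z); first exact: line_in.
  by rewrite !inE eqxx.
apply/exists_inP; exists (line x y); first exact: line_in.
by rewrite !inE !eqxx orbT.
Qed.

Lemma deficiencyE (x : P) : [set y | deficiency_graph lines x y] = [set y | e x y].
Proof. by apply/setP => y; rewrite !inE /deficiency_graph collinearE negbK. Qed.

Lemma line_card (l : {set P}) : l \in lines -> #|l| = 3.
Proof.
case/linesP => x [y [xy ne ->]]; apply: cards3_third.
have [zx _ _ _] := thirdP xy ne; have [zy _] := third_neqr xy ne.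
by rewrite /= !inE negb_or xy eq_sym zx eq_sym zy.
Qed.

Lemma lines_pls : partial_linear_space lines.
Proof.
move=> x y xy l m lL mL xl yl xm ym.
by have [_ ->] := line_any lL xl yl xy; have [_ ->] := line_any mL xm ym xy.
Qed.

(** All points but [x] and its three neighbours are joined to [x]: there are [v - 4 = 2 r] of them,
    two on each line. *)
Lemma line_degree (x : P) : #|[set l in lines | x \in l]| = r.
Proof.
have := star_card x lines_pls line_card.
have -> : [set y | (y != x) && collinear lines x y] = ~: (x |: [set y | e x y]).
  by apply/setP => y; rewrite !inE negb_or collinearE.
have := cardsC (x |: [set y | e x y]).
rewrite cardsU1 inE e_irr e_card /= card_ord.
by move: #|pred_of_set (~: _)| => n; move: vE #|_|; lia.
Qed.

Lemma nbhd_line (x : P) : [set y | e x y] \in lines.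
Proof.
case: data => /(_ _ (ltn_ord x)) /and5P[/eqP sz un _ /allP al] + _ _.
rewrite /e; case E: (nb x) sz un al => [|a [|b [|c []]]] // _ un al /andP[_].
have lt y : y \in [:: a; b; c] -> y < v by rewrite -E; exact: nb_lt.
have la : a < v by apply: lt; rewrite !inE eqxx.
have lb : b < v by apply: lt; rewrite !inE eqxx orbT.
have lc : c < v by apply: lt; rewrite !inE eqxx !orbT.
move/allP => /(_ a); rewrite !inE eqxx => /(_ isT) /allP /(_ b).
rewrite !inE eqxx orbT => /(_ isT) /implyP.
case/and3P: (un); rewrite !inE !negb_or => /andP[ab ac] bc _ => /(_ ab).
case/andP => nab tabc.
have nexy : ~~ e (Ordinal la) (Ordinal lb) by [].
have [tx _ _ _] := @thirdP (Ordinal la) (Ordinal lb) ab nexy.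
have [ty _] := @third_neqr (Ordinal la) (Ordinal lb) ab nexy.
(* The third point of [a] and [b] lies in the neighbourhood [{a, b, c}] and differs from [a] and
   [b]. *)
have tE : val (third (Ordinal la) (Ordinal lb)) = c.
  have tv : t a b < v by apply: lt; rewrite !inE.
  move: tx ty; rewrite -!val_eqE /third insubT /= => /negbTE tx /negbTE ty.
  by move: tabc; rewrite tx ty /= => /eqP.
rewrite (_ : [set y | _] = line (Ordinal la) (Ordinal lb)); first exact: line_in.
by apply/setP => y; rewrite !inE -!val_eqE tE /= orbA.
Qed.

Lemma code_injective :
  identifying_code (deficiency_graph lines) [set x : P | S x].
Proof.
move=> x y; rewrite /nbhd !deficiencyE => /setP eqS; apply/eqP/negPn/negP => xy.
case: data => _ /(_ x y (ltn_ord _) (ltn_ord _)) + _; rewrite /pair_ok.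
rewrite -val_eqE /= in xy; rewrite xy /=.
move=> /andP[/orP[]/hasP[z zx /andP[Sz /negbTE zn]] _].
  by have:= eqS (Ordinal (nb_lt zx)); rewrite !inE /e /= zx Sz zn.
by have:= eqS (Ordinal (nb_lt zx)); rewrite !inE /e /= zx Sz zn.
Qed.

Lemma code_card : #|[set x : P | S x]| = r + 2.
Proof.
case: data => _ _; rewrite cardsE cardE /enum_mem size_filter -enumT.
rewrite -{1}(val_enum_ord v) count_map (@eq_count _ _ (fun x : P => S x)) //.
lia.
Qed.

End Geometry.

(** The fraction equals [r + 3 / 2]. *)
Lemma best_code_bound (r : nat) :
  (Num.ceil (2%:R * ((2 * r + 4)%:R - 1) / (3%:R + 1) : rat) = (r + 2)%:Z)%R.
Proof.
apply: ceil_def; rewrite intrB -pmulrn (natrD _ (2 * r)) natrM (natrD _ r) mulr1z.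
rewrite (_ : 3 + 1 = 4 :> rat)%R //.
by move: (r%:R : rat)%R => x; apply/andP; split; lra.
Qed.

Lemma pent_order_geometry (r : nat) : 0 < r ->
  pent_order (2 * r + 4) -> exists_pent_with_best_code 3 r.
Proof.
move=> r_gt0 [nb [t [S data]]].
exists 'I_(2 * r + 4), (lines (2 * r + 4) nb t); split.
  split.
  - by rewrite card_ord addnS.
  - exact: lines_pls data.
  - exact: line_card data.
  - exact: line_degree data r_gt0 erefl.
  - by move=> x; rewrite (deficiencyE data r_gt0 erefl); exact: nbhd_line data x.
exists [set x | S (val x)]; split.
- by move=> x; rewrite /nbhd (deficiencyE data r_gt0 erefl); exact: e_card data x.
- exact (code_injective data r_gt0 erefl).
- by rewrite (code_card data r_gt0 erefl) card_ord best_code_bound.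
Qed.

(** * Recursive construction *)

Section Filling.

Variables (k g w : nat) (cross : nat -> nat -> nat).
Hypotheses (g_gt0 : 0 < g) (w_le : w <= g).
Let v := k * g + w.
Hypothesis crossP : forall x y, x < v -> y < v -> x %/ g != y %/ g ->
  let z := cross x y in
  [/\ z < v, z %/ g != x %/ g, z %/ g != y %/ g, cross y x = z & cross x z = y].

Variables (nb1 nb2 : nat -> seq nat) (t1 t2 : nat -> nat -> nat).
Variables (S1 S2 : pred nat).
Hypotheses (data1 : pent_data g nb1 t1 S1) (data2 : pent_data w nb2 t2 S2).

(** Point [a] of group [i] is the number [i * g + a]. There are [k] groups of size [g] and a last
    one of size [w]; as [w <= g], division by [g] recovers [i] and [a] in every group. *)
Let sz i := if i < k then g else if i == k then w else 0.
Let nbs i := if i < k then nb1 else nb2.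
Let ts i := if i < k then t1 else t2.
Let Ss i := if i < k then S1 else S2.

Definition fill_nb x := [seq x %/ g * g + y | y <- nbs (x %/ g) (x %% g)].
Definition fill_third x y :=
  if x %/ g == y %/ g then x %/ g * g + ts (x %/ g) (x %% g) (y %% g)
  else cross x y.
Definition fill_code x := Ss (x %/ g) (x %% g).

Lemma sz_le i : sz i <= g.
Proof. by rewrite /sz; case: ifP => // _; case: ifP. Qed.

Lemma fill_divmod i a : a < g -> ((i * g + a) %/ g = i) * ((i * g + a) %% g = a).
Proof.
by move=> ag; rewrite divnMDl // divn_small // addn0 modnMDl modn_small.
Qed.

Lemma fill_ltE i a : a < g -> (i * g + a < v) = (a < sz i).
Proof.
rewrite /v /sz => ag; case: (ltngtP i k) => [ik|ik|->]; last by rewrite ltn_add2l.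
  rewrite ag; apply: leq_trans (_ : i.+1 * g <= _); first by rewrite mulSn; lia.
  by apply: leq_trans (leq_addr _ _); rewrite leq_mul2r ik orbT.
apply/negbTE; rewrite -leqNgt; apply: leq_trans (leq_addr _ _).
apply: leq_trans (_ : k.+1 * g <= _); first by rewrite mulSn; lia.
by rewrite leq_mul2r ik orbT.
Qed.

Lemma fill_coords x : x < v ->
  exists i a, [/\ a < sz i, a < g & x = i * g + a].
Proof.
move=> xv; exists (x %/ g), (x %% g); have ag := ltn_pmod x g_gt0.
by split=> //; [rewrite -fill_ltE // -divn_eq|exact: divn_eq].
Qed.

Lemma fill_pointP i a : a < sz i -> point_ok (sz i) (nbs i) (ts i) (Ss i) a.
Proof.
rewrite /sz /nbs /ts /Ss; case: (ltngtP i k) => // _; last by case: data2 => + _ _; apply.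
by case: data1 => + _ _; apply.
Qed.

Lemma fill_pairP i a b : a < sz i -> b < sz i ->
  pair_ok (sz i) (nbs i) (ts i) (Ss i) a b.
Proof.
rewrite /sz /nbs /ts /Ss; case: (ltngtP i k) => // _; last by case: data2 => _ + _; apply.
by case: data1 => _ + _; apply.
Qed.

Lemma nbs_lt i a b : a < sz i -> b \in nbs i a -> b < sz i.
Proof.
by case/fill_pointP/and5P => _ _ _ /allP al _ /al /andP[].
Qed.

Lemma fill_nbE i a : a < g -> fill_nb (i * g + a) = [seq i * g + y | y <- nbs i a].
Proof. by move=> ag; rewrite /fill_nb !fill_divmod. Qed.

Lemma fill_thirdE i a b : a < g -> b < g ->
  fill_third (i * g + a) (i * g + b) = i * g + ts i a b.
Proof. by move=> ag bg; rewrite /fill_third !fill_divmod // eqxx. Qed.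

Lemma fill_point_ok x : x < v -> point_ok v fill_nb fill_third fill_code x.
Proof.
case/fill_coords => i [a [asz ag ->]].
have ltg b : b \in nbs i a -> b < g.
  by move=> /(nbs_lt asz) bs; apply: leq_trans bs (sz_le i).
have /and5P[szn un irr /allP al /andP[hS /allP cl]] := fill_pointP asz.
have inj : injective (addn (i * g)) by move=> ? ? /addnI.
rewrite /point_ok fill_nbE // size_map szn map_inj_uniq // un mem_map // irr /=.
apply/and3P; split.
- apply/allP => _ /mapP[b bn ->]; have bg := ltg _ bn.
  by rewrite fill_ltE // fill_nbE // mem_map // al.
- rewrite has_map; case/hasP: hS => b bn Sb; apply/hasP; exists b => //=.
  by rewrite /fill_code !fill_divmod ?ltg.
apply/allP => _ /mapP[b bn ->]; apply/allP => _ /mapP[c cn ->].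
have := allP (cl _ bn) _ cn; rewrite eqn_add2l; case: (b == c) => //=.
by rewrite fill_nbE ?ltg // fill_thirdE ?ltg // !mem_map.
Qed.

Lemma fill_separated i a b : a < sz i -> b < sz i ->
  separated (nbs i) (Ss i) a b ->
  separated fill_nb fill_code (i * g + a) (i * g + b).
Proof.
move=> asz bsz.
have ag : a < g by apply: leq_trans asz (sz_le i).
have bg : b < g by apply: leq_trans bsz (sz_le i).
have inj : injective (addn (i * g)) by move=> ? ? /addnI.
rewrite /separated !fill_nbE // !has_map => /orP[]/hasP[c cn /andP[Sc nc]];
  apply/orP; [left|right]; apply/hasP; exists c => //=;
  rewrite mem_map // nc andbT /fill_code !fill_divmod //;
  by apply: leq_trans (nbs_lt _ cn) (sz_le i).
Qed.

Lemma fill_pair_ok x y : x < v -> y < v ->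
  pair_ok v fill_nb fill_third fill_code x y.
Proof.
move=> xv yv; apply/implyP => xy.
case: (eqVneq (x %/ g) (y %/ g)) => [exy|nexy].
  have [i [a [asz ag xE]]] := fill_coords xv.
  have [j [b [bsz bg yE]]] := fill_coords yv.
  have ij : i = j by move: exy; rewrite xE yE !fill_divmod.
  subst j x y; have inj : injective (addn (i * g)) by move=> ? ? /addnI.
  have ab : a != b by rewrite eqn_add2l in xy.
  have := implyP (fill_pairP asz bsz) ab.
  case/andP => sep ok; rewrite fill_separated //=.
  rewrite fill_nbE // mem_map //; case: (b \in _) ok => //=.
  rewrite fill_thirdE // => /and5P[tsz ta tn /eqP tab /eqP tba].
  have tg := leq_trans tsz (sz_le i).
  by rewrite fill_ltE // tsz eqn_add2l ta mem_map // tn !fill_thirdE // tab tba !eqxx.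
have [zv zx zy czx czz] := crossP xv yv nexy.
have nbi u z : z \in fill_nb u -> u < v -> z %/ g = u %/ g.
  move=> zn /fill_coords[i [a [asz ag uE]]]; move: zn.
  rewrite uE fill_nbE // => /mapP[b bn ->].
  by rewrite !fill_divmod // (leq_trans (nbs_lt asz bn) (sz_le i)).
(* A code point adjacent to [x] lies in the group of [x], hence it is not adjacent to [y]. *)
have sep : separated fill_nb fill_code x y.
  have /and5P[_ _ _ _ /andP[/hasP[c cn Sc] _]] := fill_point_ok xv.
  apply/orP; left; apply/hasP; exists c; rewrite ?Sc //=.
  apply/negP => /nbi /(_ yv) cy; move/nbi: cn => /(_ xv) cx.
  by rewrite -cx -cy eqxx in nexy.
rewrite sep /= /fill_third (negbTE nexy) [y %/ g == _]eq_sym (negbTE nexy).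
rewrite [x %/ g == cross x y %/ g]eq_sym (negbTE zx) zv czx czz !eqxx !andbT /=.
apply/orP; right; apply/andP; split.
  by apply/eqP => zE; move: zx; rewrite zE eqxx.
by apply/negP => /nbi /(_ xv) zE; move: zx; rewrite zE eqxx.
Qed.

Lemma fill_code_count : 2 * count fill_code (iota 0 v) = v.
Proof.
have block i : count fill_code (iota (i * g) (sz i)) = count (Ss i) (iota 0 (sz i)).
  rewrite -[i * g]addn0 iotaDl count_map; apply: eq_in_count => a.
  rewrite mem_iota /= => asz.
  by rewrite /fill_code !fill_divmod // (leq_trans asz (sz_le i)).
have pre j : j <= k -> 2 * count fill_code (iota 0 (j * g)) = j * g.
  elim: j => // j IH jk; have {}IH := IH (ltnW jk).
  have := block j; rewrite /sz /Ss jk => bj.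
  case: data1 => _ _ cg.
  by rewrite (mulSn j) [g + _]addnC iotaD count_cat mulnDr IH add0n bj cg.
have := block k; rewrite /sz /Ss ltnn eqxx => bk; case: data2 => _ _ cw.
by rewrite /v iotaD count_cat mulnDr pre // add0n bk cw.
Qed.

Lemma fill_data : pent_data v fill_nb fill_third fill_code.
Proof.
by split; [exact: fill_point_ok|exact: fill_pair_ok|exact: fill_code_count].
Qed.

End Filling.

Lemma pent_fill (k g w : nat) (cross : nat -> nat -> nat) :
    0 < g -> w <= g -> pent_order g -> pent_order w ->
    (forall x y, x < k * g + w -> y < k * g + w -> x %/ g != y %/ g ->
      let z := cross x y in
      [/\ z < k * g + w, z %/ g != x %/ g, z %/ g != y %/ g, cross y x = z &
          cross x z = y]) ->
  pent_order (k * g + w).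
Proof.
move=> g0 wg [nb1 [t1 [S1 d1]]] [nb2 [t2 [S2 d2]]] cP.
by do 3!eexists; exact: (fill_data g0 wg cP d1 d2).
Qed.

(** * The 3-GDD of type g^3 w^1 *)

Section TruncatedDesign.

Variables (p m : nat).
(** The form [p.+2] ensures that ['Z_n] is the ring of residues modulo [n]; below 2 it would be the
    residues modulo 2. *)
Let n := p.+2.
Hypotheses (n_odd : odd n) (m_le : m <= n).
Let g := 2 * n.
Let w := 2 * m.

Local Open Scope ring_scope.

(* The blocks of TD(4, n) are indexed by s in Z_n^2; the block s meets group i
   in the point slope i . s, and n odd makes the slopes pairwise independent. *)
Definition slope (i : nat) : 'Z_n * 'Z_n :=
  nth (0, 0) [:: (1, 0); (0, 1); (1, 1); (1, - 1)] i.
Definition td_det (i j : nat) : 'Z_n :=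
  (slope i).1 * (slope j).2 - (slope j).1 * (slope i).2.
Definition td_point (i : nat) (s : 'Z_n * 'Z_n) : 'Z_n :=
  (slope i).1 * s.1 + (slope i).2 * s.2.
(** Cramer's rule for the block that meets group [i] in [a] and group [j] in [b]. *)
Definition td_block (i j : nat) (a b : 'Z_n) : 'Z_n * 'Z_n :=
  (((slope j).2 * a - (slope i).2 * b) / td_det i j,
   ((slope i).1 * b - (slope j).1 * a) / td_det i j).

(** All determinants are [1] or [-1], except that the slopes [(1, 1)] and [(1, -1)] give [2] up to
    sign, a unit because [n] is odd. *)
Lemma td_det_unit (i j : nat) : (i < 4)%N -> (j < 4)%N -> i != j ->
  td_det i j \is a GRing.unit.
Proof.
have u2 : (2%:R : 'Z_n) \is a GRing.unit.
  by rewrite unitZpE // coprimen2.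
rewrite /td_det /slope.
by case: i => [|[|[|[|//]]]] _; case: j => [|[|[|[|//]]]] _ //= _;
  rewrite ?(mul1r, mul0r, mulr1, mulr0, subr0, sub0r, opprK, mulN1r, mulrN1);
  rewrite -?opprD ?unitrN ?unitr1.
Qed.

Lemma td_point_block (i j : nat) (a b : 'Z_n) :
    (i < 4)%N -> (j < 4)%N -> i != j ->
  td_point i (td_block i j a b) = a /\ td_point j (td_block i j a b) = b.
Proof.
move=> i4 j4 ij; have := mulVr (td_det_unit i4 j4 ij).
rewrite /td_point /td_block /td_det /=; set d := (_ - _)^-1 => dE.
split.
  by rewrite -[RHS]mul1r -dE; ring.
by rewrite -[RHS]mul1r -dE; ring.
Qed.

Lemma td_blockK (i j : nat) (s : 'Z_n * 'Z_n) :
    (i < 4)%N -> (j < 4)%N -> i != j ->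
  td_block i j (td_point i s) (td_point j s) = s.
Proof.
move=> i4 j4 ij; have := mulVr (td_det_unit i4 j4 ij).
rewrite /td_point /td_block /td_det /=; set d := (_ - _)^-1 => dE.
case: s => s1 s2 /=; congr pair.
  by rewrite -[RHS]mul1r -dE; ring.
by rewrite -[RHS]mul1r -dE; ring.
Qed.

Local Close Scope ring_scope.

(* The 3-GDDs of type 2^4 (AG(2, 3) minus a point) and 2^3, with groups
   {2 i, 2 i + 1}. *)
Definition gdd_blocks (full : bool) : seq (seq nat) :=
  if full then [:: [:: 0; 2; 5]; [:: 1; 3; 4]; [:: 0; 3; 7]; [:: 1; 2; 6];
                   [:: 0; 4; 6]; [:: 1; 5; 7]; [:: 2; 4; 7]; [:: 3; 5; 6]]
  else [:: [:: 0; 2; 4]; [:: 0; 3; 5]; [:: 1; 2; 5]; [:: 1; 3; 4]].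

Definition gdd_third (full : bool) (c d : nat) : nat :=
  head 0 [seq x <- flatten [seq l <- gdd_blocks full | (c \in l) && (d \in l)]
             | (x != c) && (x != d)].

Definition gdd_size (full : bool) : nat := if full then 8 else 6.

Lemma gdd_thirdP (full : bool) (c d : nat) :
    c < gdd_size full -> d < gdd_size full -> c./2 != d./2 ->
  let x := gdd_third full c d in
  [/\ x < gdd_size full, x./2 != c./2, x./2 != d./2, gdd_third full d c = x &
      gdd_third full c x = d].
Proof.
have ok : all (fun b => all (fun c => all (fun d => (c./2 != d./2) ==>
      let x := gdd_third b c d in
      [&& x < gdd_size b, x./2 != c./2, x./2 != d./2, gdd_third b d c == x &
      gdd_third b c x == d]) (iota 0 (gdd_size b))) (iota 0 (gdd_size b)))
    [:: true; false] by [].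
move=> cs ds cd; move/allP: ok => /(_ full); rewrite !inE; case: full cs ds.
  move=> cs ds /(_ isT) /allP /(_ c); rewrite mem_iota cs => /(_ isT).
  move=> /allP /(_ d); rewrite mem_iota ds => /(_ isT) /implyP /(_ cd).
  by case/and5P => ? ? ? /eqP ? /eqP ?.
move=> cs ds /(_ isT) /allP /(_ c); rewrite mem_iota cs => /(_ isT).
move=> /allP /(_ d); rewrite mem_iota ds => /(_ isT) /implyP /(_ cd).
by case/and5P => ? ? ? /eqP ? /eqP ?.
Qed.

(* A point x of group x %/ g is the pair of its residue (x %% g)./2 mod n and
   its code 2 * (x %/ g) + (parity of x) among the points of [gdd_blocks]. *)
Definition gcode (x : nat) : nat := 2 * (x %/ g) + odd x.
Definition gres (x : nat) : 'Z_n := inZp (x %% g)./2.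
Definition gpoint (c : nat) (q : 'Z_n) : nat := c./2 * g + (2 * q + odd c).

(** Wilson's construction with weight 2: [s] is the block of the transversal design below [x] and
    [y]. It carries a 3-GDD of type 2^4 if its point in the fourth group survives the truncation,
    and one of type 2^3 otherwise. *)
Definition td_cross (x y : nat) : nat :=
  let s := td_block (x %/ g) (y %/ g) (gres x) (gres y) in
  let c := gdd_third (td_point 3 s < m) (gcode x) (gcode y) in
  gpoint c (td_point c./2 s).

Lemma gpoint_small (c : nat) (q : 'Z_n) : 2 * q + odd c < g.
Proof.
have qn : q < p.+2 := ltn_ord q.
by rewrite /g /n; move: (nat_of_ord q) qn => k; case: (odd c); lia.
Qed.

Lemma gpoint_div (c : nat) (q : 'Z_n) : gpoint c q %/ g = c./2.
Proof.
by rewrite /gpoint divnMDl ?divn_small ?addn0 ?gpoint_small //; rewrite /g.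
Qed.

Lemma gpoint_mod (c : nat) (q : 'Z_n) : gpoint c q %% g = 2 * q + odd c.
Proof. by rewrite /gpoint modnMDl modn_small ?gpoint_small. Qed.

Lemma gcodeK (c : nat) (q : 'Z_n) : gcode (gpoint c q) = c.
Proof.
rewrite /gcode gpoint_div /gpoint /g !mul2n !oddD oddM !odd_double andbF oddb.
by rewrite -[RHS]odd_double_half addnC.
Qed.

Lemma gresK (c : nat) (q : 'Z_n) : gres (gpoint c q) = q.
Proof.
apply: val_inj; rewrite /= gpoint_mod mul2n addnC half_bit_double.
by rewrite modn_small // -[X in _ < X]/n ltn_ord.
Qed.

Lemma odd_modg (x : nat) : odd (x %% g) = odd x.
Proof. by rewrite {2}(divn_eq x g) oddD !oddM /= andbF. Qed.

Lemma gres_val (x : nat) : gres x = (x %% g)./2 :> nat.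
Proof.
rewrite /= modn_small //.
change ((x %% g)./2 < n); rewrite ltn_half_double -mul2n.
exact: ltn_pmod.
Qed.

Lemma gcode_half (x : nat) : (gcode x)./2 = x %/ g.
Proof. by rewrite /gcode mul2n addnC half_bit_double. Qed.

Lemma gcode_odd (x : nat) : odd (gcode x) = odd x.
Proof. by rewrite /gcode mul2n oddD odd_double oddb. Qed.

Lemma gpointK (x : nat) : gpoint (gcode x) (gres x) = x.
Proof.
rewrite /gpoint gcode_half gcode_odd gres_val -odd_modg mul2n.
by rewrite [_.*2 + _]addnC odd_double_half -divn_eq.
Qed.

Lemma gpoint_lt (c : nat) (q : 'Z_n) :
  (gpoint c q < 3 * g + w) = (c < 6) || (c < 8) && (q < m).
Proof.
have small := gpoint_small c q; have [c6|c6] /= := ltnP c 6.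
  apply: leq_trans (leq_addr _ _); rewrite /gpoint.
  apply: leq_trans (_ : (c./2).+1 * g <= _).
    by rewrite (mulSn c./2) [g + _]addnC ltn_add2l.
  by rewrite leq_mul2r; apply/orP; right; lia.
have [c8|c8] /= := ltnP c 8.
  have -> : gpoint c q = 3 * g + (2 * q + odd c).
    by rewrite /gpoint (_ : c./2 = 3) //; lia.
  by rewrite ltn_add2l /w; case: (odd c); lia.
apply/negbTE; rewrite -leqNgt /gpoint; apply: leq_trans (leq_addr _ _).
apply: leq_trans (_ : 4 * g <= _); first by rewrite /g /w; lia.
by rewrite leq_mul2r; apply/orP; right; lia.
Qed.

Lemma td_crossP (x y : nat) :
    x < 3 * g + w -> y < 3 * g + w -> x %/ g != y %/ g ->
  let z := td_cross x y in
  [/\ z < 3 * g + w, z %/ g != x %/ g, z %/ g != y %/ g, td_cross y x = z &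
      td_cross x z = y].
Proof.
move=> xv yv xy; rewrite /td_cross.
have group4 u : u < 3 * g + w -> u %/ g < 4.
  move=> uv; rewrite ltn_divLR //; apply: leq_trans uv _.
  by rewrite /g /w; lia.
have xg := group4 x xv; have yg := group4 y yv.
have [px py] := td_point_block (gres x) (gres y) xg yg xy.
set s := td_block _ _ _ _ in px py *; set full := td_point 3 s < m.
(* A point of the fourth group has its residue below [m], so a block through it keeps four points
   and all eight codes are available. *)
have code u : u < 3 * g + w -> td_point (u %/ g) s = gres u ->
    gcode u < gdd_size full.
  rewrite -{1}(gpointK u) gpoint_lt => /orP[c6 _|/andP[c8 resm] pu].
    by rewrite /gdd_size; case: ifP => // _; apply: ltn_trans c6 _.
  have [c6|c6] := ltnP (gcode u) 6.
    by rewrite /gdd_size; case: ifP => // _; apply: ltn_trans c6 _.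
  have u3 : u %/ g = 3 by rewrite -gcode_half; lia.
  by move: pu; rewrite u3 => pu; rewrite /gdd_size /full pu resm.
have cx := code x xv px; have cy := code y yv py.
have cxy : (gcode x)./2 != (gcode y)./2 by rewrite !gcode_half.
have [] := gdd_thirdP cx cy cxy; set c := gdd_third _ _ _.
rewrite !gcode_half => cs cnx cny cC cK.
have c4 : c./2 < 4 by move: cs; rewrite /gdd_size; case: ifP; lia.
(* The third point lies above the same block [s], so the pair it forms with [x] is treated by the
   same small 3-GDD. *)
have zx : td_block (x %/ g) c./2 (gres x) (td_point c./2 s) = s.
  by rewrite -px td_blockK // eq_sym.
have sC : td_block (y %/ g) (x %/ g) (gres y) (gres x) = s.
  by rewrite -px -py td_blockK // eq_sym.
rewrite sC gpoint_div gcodeK gresK zx -/full cC cK gpoint_lt; split=> //.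
  move: cs; rewrite /gdd_size; case: (ltnP c 6) => //= c6.
  case: ifP => [fullT c8|_ c6']; last by move: c6'; rewrite ltnNge c6.
  have -> : c./2 = 3 by lia.
  by rewrite c8.
by rewrite gcode_half py gpointK.
Qed.

End TruncatedDesign.

(** [g %% 4 = 2] says that [g / 2] is odd, and [2 < g] excludes [g / 2 = 1]. *)
Lemma pent_order_3gw (g w : nat) : 2 < g -> g %% 4 = 2 -> ~~ odd w -> w <= g ->
  pent_order g -> pent_order w -> pent_order (3 * g + w).
Proof.
move=> g1 g4 w2 wg pg pw.
have [p [m [gE wE n_odd mn]]] : exists p m,
    [/\ g = 2 * p.+2, w = 2 * m, odd p.+2 & m <= p.+2].
  by exists (g./2 - 2), w./2; split; lia.
subst g w; apply: (pent_fill (cross := td_cross p m)) => //.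
exact: td_crossP.
Qed.

(** * Cyclic constructions *)

Section Automorphism.

Variables (v : nat) (nb : nat -> seq nat) (t : nat -> nat -> nat) (S : pred nat).
Variable f : nat -> nat.
Hypotheses (f_lt : forall x, x < v -> f x < v)
  (f_inj : forall x y, x < v -> y < v -> f x = f y -> x = y)
  (f_nb : forall x, x < v -> nb (f x) = map f (nb x))
  (f_t : forall x y, x < v -> y < v -> t (f x) (f y) = f (t x y))
  (f_S : forall x, x < v -> S (f x) = S x).
Hypothesis nb_bound : forall x y, x < v -> y \in nb x -> y < v.

Lemma mem_map_nb x y : x < v -> y < v -> (f y \in map f (nb x)) = (y \in nb x).
Proof.
move=> xv yv; apply/mapP/idP => [[z zx /f_inj ->]|yx] //; last by exists y.
exact: nb_bound zx.
Qed.

(** Together with [pair_ok_aut] this reduces the verification of the data to representatives of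
    orbits of points and of pairs. *)
Lemma point_ok_aut x : x < v -> point_ok v nb t S x -> point_ok v nb t S (f x).
Proof.
move=> xv /and5P[szn un irr al /andP[hS cl]]; have nbv := nb_bound xv.
have injx : {in nb x &, injective f}.
  by move=> y z /nbv yv /nbv zv; apply: f_inj.
rewrite /point_ok f_nb // size_map szn map_inj_in_uniq // un mem_map_nb // irr /=.
apply/and3P; split.
- apply/allP => _ /mapP[y yx ->]; have yv := nbv _ yx.
  by rewrite f_lt // f_nb // mem_map_nb //; case/andP: (allP al _ yx).
- case/hasP: hS => y yx Sy; apply/hasP; exists (f y); first exact: map_f.
  by rewrite f_S ?nbv.
apply/allP => _ /mapP[y yx ->]; apply/allP => _ /mapP[z zx ->].
have yv := nbv _ yx; have zv := nbv _ zx; apply/implyP => fyz.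
have yz : y != z by apply: contraNneq fyz => ->.
have /andP[zy txy] := implyP (allP (allP cl _ yx) _ zx) yz.
by rewrite f_nb // mem_map_nb // zy f_t // mem_map_nb // (nbv _ txy).
Qed.

Lemma separated_aut x y : x < v -> y < v -> separated nb S x y ->
  separated nb S (f x) (f y).
Proof.
move=> xv yv /orP[]/hasP[z zn /andP[Sz nz]]; apply/orP; [left|right];
  apply/hasP; exists (f z).
- by rewrite f_nb // map_f.
- by rewrite f_nb // mem_map_nb ?(nb_bound xv zn) // nz f_S ?(nb_bound xv zn) // Sz.
- by rewrite f_nb // map_f.
- by rewrite f_nb // mem_map_nb ?(nb_bound yv zn) // nz f_S ?(nb_bound yv zn) // Sz.
Qed.

Lemma pair_ok_aut x y : x < v -> y < v ->
  pair_ok v nb t S x y -> pair_ok v nb t S (f x) (f y).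
Proof.
move=> xv yv ok; apply/implyP => fxy.
have xy : x != y by apply: contraNneq fxy => ->.
have /andP[sep] := implyP ok xy.
rewrite (separated_aut xv yv sep) f_nb // mem_map_nb //; case: (y \in nb x) => //=.
case/and5P => zv zx zn /eqP xz /eqP yx.
rewrite !f_t // f_lt // mem_map_nb // zn xz yx !eqxx !andbT /=.
by apply: contraNneq zx => /f_inj ->.
Qed.

End Automorphism.

(* Points x < c * q are the pairs (x %/ q, x %% q) of an orbit and an element
   of Z_q; the h points from c * q on are fixed. Orbit number i has base point
   [orbit_rep i], and all data are read off tables indexed by orbits. *)
Section CyclicDevelopment.

Variables (q c h : nat) (nbs : seq (seq nat)) (ts : seq (seq nat)) (Ss : bitseq).
Let v := c * q + h.

Definition shift (a x : nat) : nat :=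
  if x < c * q then x %/ q * q + (x %% q + a) %% q else x.
Definition orbit_of (x : nat) : nat :=
  if x < c * q then x %/ q else c + (x - c * q).
Definition phase (x : nat) : nat := if x < c * q then x %% q else 0.
Definition orbit_rep (i : nat) : nat :=
  if i < c then i * q else c * q + (i - c).

Definition dev_nb (x : nat) : seq nat :=
  map (shift (phase x)) (nth [::] nbs (orbit_of x)).
(** [x] is rotated to the representative of its orbit, the table is read there, and the result is
    rotated back; [q - phase x] is the inverse rotation. *)
Definition dev_row (x y : nat) : nat :=
  shift (phase x) (nth 0 (nth [::] ts (orbit_of x)) (shift (q - phase x) y)).
(** The table is read from a moving point whenever there is one, because a fixed point has no phase
    to rotate by. For two fixed points, [maxn] forces a fixed result, so that [dev_third] commutes
    with the rotations whatever the tables contain. *)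
Definition dev_third (x y : nat) : nat :=
  if x < c * q then dev_row x y else
  if y < c * q then dev_row y x else maxn (c * q) (dev_row x y).
Definition dev_code (x : nat) : bool := nth false Ss (orbit_of x).

Let pok := point_ok v dev_nb dev_third dev_code.
Let rok := pair_ok v dev_nb dev_third dev_code.

(** A pair with a moving first point is rotated until that point is a representative; if the first
    point is fixed, the second one is rotated instead. The clause on the neighbours of fixed points
    keeps their lists unchanged under rotation. *)
Definition dev_ok : bool :=
  [&& 0 < q,
      all (fun i => pok (orbit_rep i)) (iota 0 (c + h)),
      all (fun i => all (rok (orbit_rep i)) (iota 0 v)) (iota 0 c),
      all (fun i => all (fun j => rok (orbit_rep i) (orbit_rep j))
        (iota 0 (c + h))) (iota c h) &
      all (fun x => all (leq (c * q)) (dev_nb x)) (iota (c * q) h)] &&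
  (2 * count dev_code (iota 0 v) == v).

Hypothesis ok : dev_ok.

Let q_gt0 : 0 < q.
Proof. by case/andP: ok => /and5P[]. Qed.

Lemma shift_divmod a x : x < c * q ->
  (shift a x %/ q = x %/ q) * (shift a x %% q = (x %% q + a) %% q).
Proof.
move=> xN; rewrite /shift xN divnMDl // (divn_small (ltn_pmod _ q_gt0)) addn0.
by rewrite modnMDl modn_mod.
Qed.

Lemma shift_ltN a x : (shift a x < c * q) = (x < c * q).
Proof.
have [xN|xN] := ltnP x (c * q); last by rewrite /shift [x < _]ltnNge xN /= ltnNge xN.
by rewrite -ltn_divLR // shift_divmod // ltn_divLR.
Qed.

Lemma shift_fixed a x : c * q <= x -> shift a x = x.
Proof. by rewrite /shift ltnNge => ->. Qed.

Lemma shiftD a b x : shift a (shift b x) = shift (b + a) x.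
Proof.
have [xN|xN] := ltnP x (c * q); last by rewrite !shift_fixed.
have E d y : y < c * q -> shift d y = y %/ q * q + (y %% q + d) %% q.
  by rewrite /shift => ->.
by rewrite E ?shift_ltN // !shift_divmod // E // modnDml addnA.
Qed.

Lemma eq_shift a b x : a = b %[mod q] -> shift a x = shift b x.
Proof. by move=> ab; rewrite /shift -modnDmr ab modnDmr. Qed.

Lemma shift_id x : shift q x = x.
Proof.
have [xN|xN] := ltnP x (c * q); last by rewrite shift_fixed.
by rewrite /shift xN modnDr modn_mod -divn_eq.
Qed.

Lemma shift_lt a x : x < v -> shift a x < v.
Proof.
move=> xv; have [xN|xN] := ltnP x (c * q); last by rewrite shift_fixed.
by apply: leq_trans (leq_addr _ _); rewrite shift_ltN.
Qed.

Lemma shift_inj a : injective (shift a).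
Proof.
(* The rotation by [q * a - a] is inverse to the one by [a], their sum being a multiple of [q]. *)
move=> x y /(congr1 (shift (q * a - a))); rewrite !shiftD.
rewrite subnKC ?leq_pmull // => e; rewrite -[x]shift_id -[y]shift_id.
by rewrite -(@eq_shift (q * a)) -1?(@eq_shift (q * a) _ y) // modnn modnMr.
Qed.

Lemma orbit_shift a x : orbit_of (shift a x) = orbit_of x.
Proof.
rewrite /orbit_of shift_ltN; case: ifP => xN; first by rewrite shift_divmod.
by rewrite shift_fixed // leqNgt xN.
Qed.

Lemma phase_shift a x : x < c * q -> phase (shift a x) = (phase x + a) %% q.
Proof. by move=> xN; rewrite /phase shift_ltN xN shift_divmod. Qed.

Lemma phase_fixed x : c * q <= x -> phase x = 0.
Proof. by rewrite /phase ltnNge => ->. Qed.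

Lemma rep_shift x : x < v -> x = shift (phase x) (orbit_rep (orbit_of x)).
Proof.
move=> xv; rewrite /phase /orbit_rep /orbit_of.
have [xN|xN] := ltnP x (c * q).
  have xc : x %/ q < c by rewrite ltn_divLR.
  rewrite xc /shift ltn_mul2r q_gt0 xc mulnK // modnMl add0n modn_mod.
  exact: divn_eq.
by rewrite ltnNge leq_addr /= addKn subnKC // shift_fixed.
Qed.

Lemma orbit_lt x : x < v -> orbit_of x < c + h.
Proof.
rewrite /orbit_of /v => xv; case: (ltnP x (c * q)) => xN.
  by apply: leq_trans (leq_addr _ _); rewrite ltn_divLR.
by rewrite ltn_add2l ltn_subLR.
Qed.

Lemma rep_lt i : i < c + h -> orbit_rep i < v.
Proof.
rewrite /orbit_rep /v => ih; case: (ltnP i c) => ic.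
  by apply: leq_trans (leq_addr _ _); rewrite ltn_mul2r q_gt0.
by rewrite ltn_add2l ltn_subLR.
Qed.

Lemma fixed_closed x : c * q <= x -> x < v -> all (leq (c * q)) (dev_nb x).
Proof.
move=> xN xv; case/andP: ok => /and5P[_ _ _ _ /allP al] _.
by apply: al; rewrite mem_iota xN.
Qed.

Lemma dev_nb_shift a x : x < v -> dev_nb (shift a x) = map (shift a) (dev_nb x).
Proof.
move=> xv; have [xN|xN] := ltnP x (c * q).
  rewrite /dev_nb orbit_shift phase_shift // -map_comp; apply: eq_map => y /=.
  by rewrite shiftD; apply: eq_shift; rewrite modn_mod.
have /allP nbN := fixed_closed xN xv.
rewrite shift_fixed // -{1}[dev_nb x]map_id; apply/eq_in_map => y /nbN yN.
by rewrite shift_fixed.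
Qed.

Lemma dev_row_shift a x y : x < c * q ->
  dev_row (shift a x) (shift a y) = shift a (dev_row x y).
Proof.
move=> xN; rewrite /dev_row orbit_shift phase_shift // !shiftD.
rewrite (@eq_shift (_ %% q) (phase x + a)) ?modn_mod //; congr (shift _ (nth _ _ _)).
have pq : phase x < q by rewrite /phase xN ltn_pmod.
apply: eq_shift; apply/eqP; rewrite -(eqn_modDr (phase x)) subnK 1?ltnW //.
rewrite addnAC [a + _]addnC -modnDml addnC subnK ?modnn //.
by rewrite ltnW // ltn_pmod.
Qed.

Lemma dev_third_shift a x y :
  dev_third (shift a x) (shift a y) = shift a (dev_third x y).
Proof.
rewrite /dev_third !shift_ltN.
have [xN|xN] := ltnP x (c * q); first by rewrite dev_row_shift.
have [yN|yN] := ltnP y (c * q); first by rewrite dev_row_shift.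
by rewrite [RHS]shift_fixed ?leq_maxl // !shift_fixed.
Qed.

Lemma dev_code_shift a x : dev_code (shift a x) = dev_code x.
Proof. by rewrite /dev_code orbit_shift. Qed.

Lemma dev_nb_bound x y : x < v -> y \in dev_nb x -> y < v.
Proof.
move=> xv; case/andP: ok => /and5P[_ /allP reps _ _ _] _.
have iv := orbit_lt xv; have := reps (orbit_of x); rewrite mem_iota => /(_ iv).
case/and5P => _ _ _ /allP al _; rewrite {1}(rep_shift xv) dev_nb_shift ?rep_lt //.
by case/mapP => z /al /andP[zv _] ->; apply: shift_lt.
Qed.

Lemma dev_data : pent_data v dev_nb dev_third dev_code.
Proof.
case/andP: (ok) => /and5P[_ /allP pts /allP prs /allP fixed _] /eqP cnt.
have aut_pair a x y : x < v -> y < v -> rok x y -> rok (shift a x) (shift a y).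
  apply: pair_ok_aut.
  - exact: shift_lt.
  - by move=> ? ? _ _; apply: shift_inj.
  - exact: dev_nb_shift.
  - by move=> ? ? _ _; apply: dev_third_shift.
  - by move=> ? _; apply: dev_code_shift.
  - exact: dev_nb_bound.
split=> // [x xv|x y xv yv].
  have iv := orbit_lt xv; rewrite (rep_shift xv); apply: point_ok_aut.
  - exact: shift_lt.
  - by move=> ? ? _ _; apply: shift_inj.
  - exact: dev_nb_shift.
  - by move=> ? ? _ _; apply: dev_third_shift.
  - by move=> ? _; apply: dev_code_shift.
  - exact: dev_nb_bound.
  - exact: rep_lt.
  - by apply: pts; rewrite mem_iota.
have [xN|xN] := ltnP x (c * q).
  have ic : orbit_of x < c by rewrite /orbit_of xN ltn_divLR.
  pose y' := shift (q - phase x) y.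
  have -> : y = shift (phase x) y'.
    rewrite /y' shiftD subnK ?shift_id //.
    by rewrite /phase xN ltnW // ltn_pmod.
  rewrite {1}(rep_shift xv); apply: aut_pair.
  - by apply: rep_lt; apply: leq_trans ic (leq_addr _ _).
  - exact: shift_lt.
  by apply: (allP (prs _ _)); rewrite mem_iota //; apply: shift_lt.
have -> : x = shift (phase y) x by rewrite shift_fixed.
rewrite {2}(rep_shift yv); apply: aut_pair => //; first by rewrite rep_lt ?orbit_lt.
have ic : c <= orbit_of x by rewrite /orbit_of ltnNge xN leq_addr.
have xE : x = orbit_rep (orbit_of x).
  rewrite {1}(rep_shift xv) phase_fixed // shift_fixed //.
  by rewrite /orbit_rep ltnNge ic leq_addr.
rewrite xE; apply: (allP (fixed _ _)).
  by rewrite mem_iota ic orbit_lt.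
by rewrite mem_iota orbit_lt.
Qed.

End CyclicDevelopment.

(** From base lines to tables: a base line gives one entry for each ordered pair of its points,
    after the first point has been rotated to phase 0. For a fixed first point the rotation is by
    [q], the identity. *)
Definition dev_tables (q c : nat) (tr : seq (nat * nat * nat)) : seq (seq nat) :=
  let entry tb x y z :=
    let i := orbit_of q c x in let s := shift q c (q - phase q c x) in
    set_nth [::] tb i (set_nth 0 (nth [::] tb i) (s y) (s z)) in
  foldl (fun tb l => let: (x, y, z) := l in
    foldl (fun tb l => let: (x, y, z) := l in entry (entry tb x y z) x z y)
      tb [:: (x, y, z); (y, x, z); (z, x, y)]) [::] tr.

Lemma dev_order (q c h : nat) (nbs : seq (seq nat))
    (tr : seq (nat * nat * nat)) (Ss : seq nat) :
  dev_ok q c h nbs (dev_tables q c tr) [seq b == 1 | b <- Ss] ->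
  pent_order (c * q + h).
Proof. by move=> ok; do 3!eexists; exact: dev_data ok. Qed.

(* Found by computer search. In the cases with h = 10 the fixed points carry a
   Petersen graph. *)
Lemma pent_order_10 : pent_order 10.
Proof.
apply: (@dev_order 5 2 0
  [:: [:: 1; 4; 5]; [:: 0; 7; 8]]
  [:: (1, 4, 5); (0, 7, 8)]
  [:: 1; 0]).
by vm_compute.
Qed.

(** With [q = 1] the rotations are trivial, so all 66 lines are listed, beginning with the 22
    neighbourhoods. *)
Lemma pent_order_22 : pent_order 22.
Proof.
apply: (@dev_order 1 22 0
  [:: [:: 14; 16; 21]; [:: 12; 17; 21]; [:: 13; 15; 21]; [:: 12; 16; 20]; [::
  13; 17; 18]; [:: 14; 15; 19]; [:: 10; 11; 14]; [:: 9; 11; 12]; [:: 9; 10;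
  13]; [:: 7; 8; 20]; [:: 6; 8; 18]; [:: 6; 7; 19]; [:: 1; 3; 7]; [:: 2; 4;
  8]; [:: 0; 5; 6]; [:: 2; 5; 20]; [:: 0; 3; 18]; [:: 1; 4; 19]; [:: 4; 10;
  16]; [:: 5; 11; 17]; [:: 3; 9; 15]; [:: 0; 1; 2]]
  [:: (14, 16, 21); (12, 17, 21); (13, 15, 21); (12, 16, 20); (13, 17, 18);
  (14, 15, 19); (10, 11, 14); (9, 11, 12); (9, 10, 13); (7, 8, 20); (6, 8,
  18); (6, 7, 19); (1, 3, 7); (2, 4, 8); (0, 5, 6); (2, 5, 20); (0, 3, 18);
  (1, 4, 19); (4, 10, 16); (5, 11, 17); (3, 9, 15); (0, 1, 2); (2, 11, 18);
  (0, 9, 19); (1, 10, 20); (14, 18, 20); (13, 19, 20); (12, 18, 19); (7, 15,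
  18); (8, 16, 19); (6, 17, 20); (2, 3, 19); (0, 4, 20); (1, 5, 18); (11, 20,
  21); (10, 19, 21); (9, 18, 21); (4, 7, 21); (5, 8, 21); (3, 6, 21); (5, 9,
  16); (3, 10, 17); (4, 11, 15); (0, 11, 13); (1, 9, 14); (2, 10, 12); (1, 11,
  16); (0, 10, 15); (2, 9, 17); (0, 8, 12); (2, 7, 14); (1, 6, 13); (5, 7,
  10); (3, 8, 11); (4, 6, 9); (6, 12, 15); (7, 13, 16); (8, 14, 17); (15, 16,
  17); (2, 6, 16); (0, 7, 17); (1, 8, 15); (12, 13, 14); (3, 5, 13); (4, 5,
  12); (3, 4, 14)]
  [:: 0; 0; 1; 0; 1; 0; 1; 1; 0; 1; 1; 0; 0; 0; 0; 1; 0; 1; 1; 0; 1; 1]).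
by vm_compute.
Qed.

Lemma pent_order_24 : pent_order 24.
Proof.
apply: (@dev_order 3 8 0
  [:: [:: 23; 12; 11]; [:: 17; 7; 23]; [:: 15; 5; 9]; [:: 6; 1; 20]; [:: 18;
  22; 0]; [:: 4; 6; 18]; [:: 12; 15; 10]; [:: 1; 4; 14]]
  [:: (11, 12, 23); (7, 17, 23); (5, 9, 15); (1, 6, 20); (0, 18, 22); (4, 6,
  18); (10, 12, 15); (1, 4, 14); (15, 20, 23); (3, 15, 19); (12, 13, 20); (9,
  18, 19); (0, 5, 20); (6, 19, 21); (0, 7, 21); (0, 4, 10); (0, 9, 16); (12,
  17, 21); (6, 13, 17); (0, 6, 14); (3, 6, 12); (3, 11, 14); (9, 10, 23); (6,
  7, 11); (3, 4, 22); (21, 22, 23); (0, 1, 2); (0, 15, 17)]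
  [:: 1; 1; 0; 1; 0; 0; 0; 1]).
by vm_compute.
Qed.

Lemma pent_order_28 : pent_order 28.
Proof.
apply: (@dev_order 7 4 0
  [:: [:: 1; 6; 19]; [:: 24; 11; 10]; [:: 2; 23; 25]; [:: 11; 19; 17]]
  [:: (1, 6, 19); (10, 11, 24); (2, 23, 25); (11, 17, 19); (7, 16, 19); (14,
  21, 24); (7, 17, 23); (0, 14, 15); (0, 17, 22); (0, 12, 16); (7, 14, 22);
  (0, 3, 10); (0, 13, 24); (0, 8, 27); (0, 9, 11); (0, 25, 26)]
  [:: 1; 1; 0; 0]).
by vm_compute.
Qed.

(** The graph is the generalised Petersen graph GP(17, 2), coded by its outer cycle: an outer point
    sees its two outer neighbours, an inner point only the outer point at its spoke. In every case
    with two moving orbits the code meets these orbits in the first one, for the same reason. *)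
Lemma pent_order_34 : pent_order 34.
Proof.
apply: (@dev_order 17 2 0
  [:: [:: 1; 16; 17]; [:: 0; 19; 32]]
  [:: (0, 3, 8); (0, 7, 11); (0, 24, 27); (0, 21, 30); (0, 22, 29); (0, 20,
  31); (0, 25, 26); (0, 23, 28); (1, 16, 17); (0, 19, 32)]
  [:: 1; 0]).
by vm_compute.
Qed.

Lemma pent_order_36 : pent_order 36.
Proof.
apply: (@dev_order 9 4 0
  [:: [:: 23; 17; 11]; [:: 1; 31; 7]; [:: 35; 4; 31]; [:: 19; 23; 14]]
  [:: (11, 17, 23); (1, 7, 31); (4, 31, 35); (14, 19, 23); (9, 13, 30); (9,
  11, 27); (9, 10, 33); (0, 32, 34); (18, 29, 30); (0, 21, 35); (18, 28, 34);
  (0, 9, 29); (0, 22, 28); (9, 19, 28); (0, 16, 24); (9, 20, 22); (18, 21,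
  24); (0, 4, 10); (0, 2, 14); (0, 13, 20); (0, 18, 19); (0, 1, 26)]
  [:: 1; 1; 0; 0]).
by vm_compute.
Qed.

Lemma pent_order_42 : pent_order 42.
Proof.
apply: (@dev_order 21 2 0
  [:: [:: 36; 8; 13]; [:: 6; 27; 36]]
  [:: (8, 13, 36); (6, 27, 36); (21, 23, 31); (0, 38, 41); (0, 22, 26); (0,
  39, 40); (0, 29, 34); (21, 28, 35); (0, 1, 32); (0, 2, 27); (0, 4, 37); (0,
  10, 24); (0, 7, 14); (0, 3, 9)]
  [:: 1; 0]).
by vm_compute.
Qed.

Lemma pent_order_46 : pent_order 46.
Proof.
apply: (@dev_order 23 2 0
  [:: [:: 1; 22; 23]; [:: 0; 27; 42]]
  [:: (23, 25, 34); (0, 10, 16); (0, 3, 8); (0, 32, 37); (0, 34, 35); (0, 28,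
  41); (0, 33, 36); (0, 31, 38); (6, 17, 23); (2, 21, 23); (7, 16, 23); (0,
  26, 43); (1, 22, 23); (0, 27, 42)]
  [:: 1; 0]).
by vm_compute.
Qed.

Lemma pent_order_48 : pent_order 48.
Proof.
apply: (@dev_order 19 2 10
  [:: [:: 1; 18; 19]; [:: 0; 27; 30]; [:: 39; 42; 43]; [:: 38; 40; 44]; [::
  39; 41; 45]; [:: 40; 42; 46]; [:: 38; 41; 47]; [:: 38; 45; 46]; [:: 39; 46;
  47]; [:: 40; 43; 47]; [:: 41; 43; 44]; [:: 42; 44; 45]]
  [:: (0, 3, 9); (19, 21, 28); (0, 8, 12); (19, 20, 25); (0, 21, 36); (7, 12,
  19); (0, 28, 38); (0, 29, 39); (0, 23, 40); (0, 34, 41); (0, 24, 42); (0,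
  33, 43); (0, 22, 44); (0, 35, 45); (0, 25, 46); (0, 32, 47); (1, 18, 19);
  (0, 27, 30); (39, 42, 43); (38, 40, 44); (39, 41, 45); (40, 42, 46); (38,
  41, 47); (38, 45, 46); (39, 46, 47); (40, 43, 47); (41, 43, 44); (42, 44,
  45)]
  [:: 1; 0; 1; 1; 1; 1; 1; 0; 0; 0; 0; 0]).
by vm_compute.
Qed.

Lemma pent_order_52 : pent_order 52.
Proof.
apply: (@dev_order 21 2 10
  [:: [:: 1; 20; 21]; [:: 0; 30; 33]; [:: 43; 46; 47]; [:: 42; 44; 48]; [::
  43; 45; 49]; [:: 44; 46; 50]; [:: 42; 45; 51]; [:: 42; 49; 50]; [:: 43; 50;
  51]; [:: 44; 47; 51]; [:: 45; 47; 48]; [:: 46; 48; 49]]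
  [:: (0, 4, 10); (21, 25, 31); (0, 3, 8); (0, 7, 14); (21, 23, 28); (6, 15,
  21); (0, 31, 32); (0, 25, 38); (0, 28, 42); (0, 35, 43); (0, 26, 44); (0,
  37, 45); (0, 24, 46); (0, 39, 47); (0, 23, 48); (0, 40, 49); (0, 29, 50);
  (0, 34, 51); (1, 20, 21); (0, 30, 33); (43, 46, 47); (42, 44, 48); (43, 45,
  49); (44, 46, 50); (42, 45, 51); (42, 49, 50); (43, 50, 51); (44, 47, 51);
  (45, 47, 48); (46, 48, 49)]
  [:: 1; 0; 1; 1; 1; 1; 1; 0; 0; 0; 0; 0]).
by vm_compute.
Qed.

Lemma pent_order_54 : pent_order 54.
Proof.
apply: (@dev_order 27 2 0
  [:: [:: 26; 1; 52]; [:: 2; 37; 44]]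
  [:: (1, 26, 52); (2, 37, 44); (0, 44, 48); (0, 34, 46); (0, 31, 32); (0, 30,
  33); (0, 39, 45); (0, 28, 36); (0, 27, 49); (27, 29, 40); (0, 7, 47); (27,
  36, 45); (0, 13, 29); (0, 4, 41); (0, 12, 50); (0, 6, 16); (0, 9, 18); (0,
  3, 8)]
  [:: 1; 0]).
by vm_compute.
Qed.

Lemma pent_order_58 : pent_order 58.
Proof.
apply: (@dev_order 29 2 0
  [:: [:: 1; 28; 29]; [:: 0; 33; 54]]
  [:: (0, 3, 14); (0, 13, 19); (0, 12, 20); (29, 31, 36); (11, 18, 29); (0,
  34, 53); (2, 27, 29); (0, 43, 44); (0, 37, 50); (0, 35, 52); (0, 38, 49);
  (0, 39, 48); (0, 42, 45); (0, 36, 51); (0, 32, 55); (12, 17, 29); (1, 28,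
  29); (0, 33, 54)]
  [:: 1; 0]).
by vm_compute.
Qed.

Lemma pent_order_60 : pent_order 60.
Proof.
apply: (@dev_order 25 2 10
  [:: [:: 1; 24; 25]; [:: 0; 27; 48]; [:: 51; 54; 55]; [:: 50; 52; 56]; [::
  51; 53; 57]; [:: 52; 54; 58]; [:: 50; 53; 59]; [:: 50; 57; 58]; [:: 51; 58;
  59]; [:: 52; 55; 59]; [:: 53; 55; 56]; [:: 54; 56; 57]]
  [:: (0, 5, 12); (25, 28, 37); (0, 3, 11); (25, 35, 42); (0, 4, 10); (0, 35,
  40); (8, 17, 25); (0, 32, 43); (0, 37, 38); (0, 28, 47); (0, 36, 50); (0,
  39, 51); (0, 34, 52); (0, 41, 53); (0, 29, 54); (0, 46, 55); (0, 31, 56);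
  (0, 44, 57); (0, 30, 58); (0, 45, 59); (1, 24, 25); (0, 27, 48); (51, 54,
  55); (50, 52, 56); (51, 53, 57); (52, 54, 58); (50, 53, 59); (50, 57, 58);
  (51, 58, 59); (52, 55, 59); (53, 55, 56); (54, 56, 57)]
  [:: 1; 0; 1; 1; 1; 1; 1; 0; 0; 0; 0; 0]).
by vm_compute.
Qed.

Lemma pent_order_64 : pent_order 64.
Proof.
apply: (@dev_order 27 2 10
  [:: [:: 1; 26; 27]; [:: 0; 31; 50]; [:: 55; 58; 59]; [:: 54; 56; 60]; [::
  55; 57; 61]; [:: 56; 58; 62]; [:: 54; 57; 63]; [:: 54; 61; 62]; [:: 55; 62;
  63]; [:: 56; 59; 63]; [:: 57; 59; 60]; [:: 58; 60; 61]]
  [:: (0, 13, 17); (0, 5, 12); (0, 3, 11); (27, 38, 44); (0, 9, 18); (27, 29,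
  34); (0, 36, 45); (0, 33, 48); (0, 40, 41); (0, 34, 47); (3, 24, 27); (0,
  39, 42); (0, 37, 54); (0, 44, 55); (0, 32, 56); (0, 49, 57); (0, 29, 58);
  (0, 52, 59); (0, 38, 60); (0, 43, 61); (0, 35, 62); (0, 46, 63); (1, 26,
  27); (0, 31, 50); (55, 58, 59); (54, 56, 60); (55, 57, 61); (56, 58, 62);
  (54, 57, 63); (54, 61, 62); (55, 62, 63); (56, 59, 63); (57, 59, 60); (58,
  60, 61)]
  [:: 1; 0; 1; 1; 1; 1; 1; 0; 0; 0; 0; 0]).
by vm_compute.
Qed.

Lemma pent_order_70 : pent_order 70.
Proof.
apply: (@dev_order 35 2 0
  [:: [:: 1; 34; 35]; [:: 0; 41; 64]]
  [:: (0, 8, 17); (0, 4, 16); (0, 15, 22); (0, 14, 24); (35, 37, 40); (0, 39,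
  66); (0, 48, 57); (0, 37, 68); (0, 52, 53); (0, 44, 61); (0, 43, 62); (0,
  40, 65); (0, 46, 59); (0, 45, 60); (0, 49, 56); (0, 42, 63); (3, 32, 35);
  (15, 20, 35); (16, 19, 35); (0, 47, 58); (1, 34, 35); (0, 41, 64)]
  [:: 1; 0]).
by vm_compute.
Qed.

Lemma pent_order_72 : pent_order 72.
Proof.
apply: (@dev_order 31 2 10
  [:: [:: 1; 30; 31]; [:: 0; 35; 58]; [:: 63; 66; 67]; [:: 62; 64; 68]; [::
  63; 65; 69]; [:: 64; 66; 70]; [:: 62; 65; 71]; [:: 62; 69; 70]; [:: 63; 70;
  71]; [:: 64; 67; 71]; [:: 65; 67; 68]; [:: 66; 68; 69]]
  [:: (0, 3, 15); (31, 45, 52); (31, 33, 44); (0, 13, 21); (0, 4, 9); (31, 32,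
  37); (0, 39, 54); (0, 37, 56); (0, 42, 51); (10, 21, 31); (0, 45, 48); (7,
  24, 31); (3, 28, 31); (12, 19, 31); (0, 36, 62); (0, 57, 63); (0, 44, 64);
  (0, 49, 65); (0, 33, 66); (0, 60, 67); (0, 46, 68); (0, 47, 69); (0, 40,
  70); (0, 53, 71); (1, 30, 31); (0, 35, 58); (63, 66, 67); (62, 64, 68); (63,
  65, 69); (64, 66, 70); (62, 65, 71); (62, 69, 70); (63, 70, 71); (64, 67,
  71); (65, 67, 68); (66, 68, 69)]
  [:: 1; 0; 1; 1; 1; 1; 1; 0; 0; 0; 0; 0]).
by vm_compute.
Qed.

Lemma pent_order_78 : pent_order 78.
Proof.
apply: (@dev_order 39 2 0
  [:: [:: 66; 14; 25]; [:: 12; 51; 66]]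
  [:: (14, 25, 66); (12, 51, 66); (0, 47, 70); (39, 47, 56); (0, 45, 55); (0,
  65, 68); (0, 59, 63); (0, 71, 72); (0, 46, 57); (0, 56, 61); (39, 41, 59);
  (0, 69, 75); (39, 52, 65); (0, 53, 60); (0, 42, 67); (0, 2, 64); (0, 9, 58);
  (0, 7, 44); (0, 10, 50); (0, 4, 77); (0, 3, 51); (0, 8, 43); (0, 5, 20); (0,
  1, 17); (0, 6, 18); (0, 13, 26)]
  [:: 1; 0]).
by vm_compute.
Qed.

Lemma pent_order_82 : pent_order 82.
Proof.
apply: (@dev_order 41 2 0
  [:: [:: 1; 40; 41]; [:: 0; 47; 76]]
  [:: (0, 3, 20); (0, 5, 19); (0, 18, 28); (0, 4, 16); (0, 7, 15); (41, 43,
  52); (0, 55, 68); (0, 49, 74); (0, 61, 62); (0, 48, 75); (0, 53, 70); (0,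
  43, 80); (0, 60, 63); (3, 38, 41); (0, 59, 64); (0, 50, 73); (0, 54, 69);
  (16, 25, 41); (0, 58, 65); (15, 26, 41); (0, 51, 72); (0, 46, 77); (0, 52,
  71); (0, 45, 78); (1, 40, 41); (0, 47, 76)]
  [:: 1; 0]).
by vm_compute.
Qed.

Lemma pent_order_84 : pent_order 84.
Proof.
apply: (@dev_order 37 2 10
  [:: [:: 1; 36; 37]; [:: 0; 43; 68]; [:: 75; 78; 79]; [:: 74; 76; 80]; [::
  75; 77; 81]; [:: 76; 78; 82]; [:: 74; 77; 83]; [:: 74; 81; 82]; [:: 75; 82;
  83]; [:: 76; 79; 83]; [:: 77; 79; 80]; [:: 78; 80; 81]]
  [:: (0, 18, 25); (0, 17, 22); (0, 16, 24); (37, 53, 63); (0, 3, 14); (37,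
  41, 50); (37, 38, 40); (2, 35, 37); (0, 48, 63); (0, 53, 58); (5, 32, 37);
  (0, 46, 65); (14, 23, 37); (0, 52, 59); (0, 47, 64); (3, 34, 37); (0, 44,
  67); (0, 41, 70); (0, 50, 74); (0, 61, 75); (0, 45, 76); (0, 66, 77); (0,
  55, 78); (0, 56, 79); (0, 54, 80); (0, 57, 81); (0, 49, 82); (0, 62, 83);
  (1, 36, 37); (0, 43, 68); (75, 78, 79); (74, 76, 80); (75, 77, 81); (76, 78,
  82); (74, 77, 83); (74, 81, 82); (75, 82, 83); (76, 79, 83); (77, 79, 80);
  (78, 80, 81)]
  [:: 1; 0; 1; 1; 1; 1; 1; 0; 0; 0; 0; 0]).
by vm_compute.
Qed.

Lemma pent_order_94 : pent_order 94.
Proof.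
apply: (@dev_order 47 2 0
  [:: [:: 1; 46; 47]; [:: 0; 53; 88]]
  [:: (0, 23, 28); (0, 22, 26); (0, 8, 20); (0, 18, 32); (0, 7, 17); (0, 3,
  16); (47, 49, 58); (0, 69, 72); (0, 55, 86); (0, 63, 78); (0, 59, 82); (0,
  70, 71); (0, 54, 87); (0, 61, 80); (0, 62, 79); (0, 49, 92); (19, 28, 47);
  (3, 44, 47); (0, 67, 74); (0, 56, 85); (0, 60, 81); (0, 57, 84); (0, 64,
  77); (18, 29, 47); (0, 52, 89); (0, 58, 83); (0, 51, 90); (0, 68, 73); (1,
  46, 47); (0, 53, 88)]
  [:: 1; 0]).
by vm_compute.
Qed.

Lemma pent_order_96 : pent_order 96.
Proof.
apply: (@dev_order 43 2 10
  [:: [:: 1; 42; 43]; [:: 0; 49; 80]; [:: 87; 90; 91]; [:: 86; 88; 92]; [::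
  87; 89; 93]; [:: 88; 90; 94]; [:: 86; 89; 95]; [:: 86; 93; 94]; [:: 87; 94;
  95]; [:: 88; 91; 95]; [:: 89; 91; 92]; [:: 90; 92; 93]]
  [:: (0, 3, 21); (0, 7, 20); (0, 19, 29); (43, 62, 71); (0, 17, 28); (0, 4,
  16); (43, 45, 59); (43, 46, 51); (0, 45, 84); (19, 24, 43); (3, 40, 43); (0,
  61, 68); (0, 52, 77); (0, 56, 73); (0, 59, 70); (17, 26, 43); (0, 58, 71);
  (0, 53, 76); (0, 48, 81); (0, 54, 75); (4, 39, 43); (0, 64, 65); (0, 57,
  86); (0, 72, 87); (0, 51, 88); (0, 78, 89); (0, 63, 90); (0, 66, 91); (0,
  50, 92); (0, 79, 93); (0, 55, 94); (0, 74, 95); (1, 42, 43); (0, 49, 80);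
  (87, 90, 91); (86, 88, 92); (87, 89, 93); (88, 90, 94); (86, 89, 95); (86,
  93, 94); (87, 94, 95); (88, 91, 95); (89, 91, 92); (90, 92, 93)]
  [:: 1; 0; 1; 1; 1; 1; 1; 0; 0; 0; 0; 0]).
by vm_compute.
Qed.

Lemma pent_order_106 : pent_order 106.
Proof.
apply: (@dev_order 53 2 0
  [:: [:: 1; 52; 53]; [:: 0; 59; 100]]
  [:: (0, 26, 37); (0, 25, 38); (0, 24, 31); (0, 5, 23); (0, 4, 21); (0, 20,
  34); (0, 3, 12); (53, 55, 63); (0, 66, 93); (0, 76, 83); (0, 60, 99); (0,
  77, 82); (0, 79, 80); (0, 61, 98); (0, 78, 81); (0, 69, 90); (0, 72, 87);
  (0, 65, 94); (0, 67, 92); (0, 73, 86); (0, 55, 104); (0, 63, 96); (3, 50,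
  53); (0, 62, 97); (0, 68, 91); (0, 75, 84); (0, 70, 89); (0, 71, 88); (5,
  48, 53); (0, 64, 95); (4, 49, 53); (0, 74, 85); (1, 52, 53); (0, 59, 100)]
  [:: 1; 0]).
by vm_compute.
Qed.

Lemma pent_order_108 : pent_order 108.
Proof.
apply: (@dev_order 49 2 10
  [:: [:: 1; 48; 49]; [:: 0; 55; 92]; [:: 99; 102; 103]; [:: 98; 100; 104];
  [:: 99; 101; 105]; [:: 100; 102; 106]; [:: 98; 101; 107]; [:: 98; 105; 106];
  [:: 99; 106; 107]; [:: 100; 103; 107]; [:: 101; 103; 104]; [:: 102; 104;
  105]]
  [:: (0, 24, 28); (49, 60, 73); (0, 3, 23); (0, 22, 34); (49, 54, 68); (49,
  51, 67); (0, 8, 17); (0, 5, 16); (49, 52, 59); (7, 42, 49); (0, 63, 84); (0,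
  65, 82); (0, 51, 96); (0, 59, 88); (3, 46, 49); (0, 73, 74); (15, 34, 49);
  (9, 40, 49); (0, 62, 85); (0, 69, 78); (0, 66, 81); (18, 31, 49); (5, 44,
  49); (0, 60, 87); (0, 53, 94); (21, 28, 49); (0, 72, 98); (0, 75, 99); (0,
  57, 100); (0, 90, 101); (0, 68, 102); (0, 79, 103); (0, 61, 104); (0, 86,
  105); (0, 71, 106); (0, 76, 107); (1, 48, 49); (0, 55, 92); (99, 102, 103);
  (98, 100, 104); (99, 101, 105); (100, 102, 106); (98, 101, 107); (98, 105,
  106); (99, 106, 107); (100, 103, 107); (101, 103, 104); (102, 104, 105)]
  [:: 1; 0; 1; 1; 1; 1; 1; 0; 0; 0; 0; 0]).
by vm_compute.
Qed.

Lemma pent_order_142 : pent_order 142.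
Proof.
apply: (@dev_order 71 2 0
  [:: [:: 1; 70; 71]; [:: 0; 81; 132]]
  [:: (0, 35, 47); (0, 34, 45); (0, 5, 33); (0, 32, 51); (0, 31, 48); (0, 30,
  46); (71, 73, 100); (0, 7, 22); (0, 8, 21); (0, 4, 18); (0, 3, 9); (0, 75,
  138); (21, 50, 71); (0, 84, 129); (0, 97, 116); (0, 106, 107); (0, 105,
  108); (0, 80, 133); (0, 95, 118); (0, 91, 122); (0, 78, 135); (0, 74, 139);
  (0, 83, 130); (0, 96, 117); (22, 49, 71); (0, 85, 128); (0, 82, 131); (0,
  101, 112); (0, 99, 114); (0, 87, 126); (0, 102, 111); (0, 73, 140); (0, 100,
  113); (0, 104, 109); (0, 79, 134); (0, 86, 127); (0, 94, 119); (0, 103,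
  110); (0, 88, 125); (0, 98, 115); (0, 89, 124); (5, 66, 71); (0, 90, 123);
  (0, 77, 136); (1, 70, 71); (0, 81, 132)]
  [:: 1; 0]).
by vm_compute.
Qed.

Lemma pent_order_144 : pent_order 144.
Proof.
apply: (@dev_order 67 2 10
  [:: [:: 1; 66; 67]; [:: 0; 77; 124]; [:: 135; 138; 139]; [:: 134; 136; 140];
  [:: 135; 137; 141]; [:: 136; 138; 142]; [:: 134; 137; 143]; [:: 134; 141;
  142]; [:: 135; 142; 143]; [:: 136; 139; 143]; [:: 137; 139; 140]; [:: 138;
  140; 141]]
  [:: (0, 3, 33); (0, 32, 48); (0, 4, 31); (0, 14, 29); (0, 7, 28); (67, 95,
  107); (0, 26, 44); (67, 69, 93); (0, 5, 25); (0, 9, 22); (67, 75, 84); (67,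
  72, 78); (3, 64, 67); (0, 74, 127); (6, 61, 67); (0, 76, 125); (0, 86, 115);
  (12, 55, 67); (0, 89, 112); (0, 100, 101); (0, 83, 118); (25, 42, 67); (0,
  69, 132); (0, 91, 110); (0, 99, 102); (0, 75, 126); (0, 82, 119); (0, 90,
  111); (0, 93, 108); (0, 84, 117); (0, 85, 116); (5, 62, 67); (0, 78, 123);
  (4, 63, 67); (0, 94, 107); (28, 39, 67); (0, 97, 104); (0, 88, 113); (0, 96,
  134); (0, 105, 135); (0, 87, 136); (0, 114, 137); (0, 81, 138); (0, 120,
  139); (0, 80, 140); (0, 121, 141); (0, 98, 142); (0, 103, 143); (1, 66, 67);
  (0, 77, 124); (135, 138, 139); (134, 136, 140); (135, 137, 141); (136, 138,
  142); (134, 137, 143); (134, 141, 142); (135, 142, 143); (136, 139, 143);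
  (137, 139, 140); (138, 140, 141)]
  [:: 1; 0; 1; 1; 1; 1; 1; 0; 0; 0; 0; 0]).
by vm_compute.
Qed.

(** * Arithmetic of the recursion *)

Lemma pent_order_0 : pent_order 0.
Proof. by exists (fun=> [::]), (fun _ _ => 0), xpred0. Qed.

(** The order [0] stands for an empty fourth group. The list goes up to 144 because the missing
    orders are missing as values of [w] too: for [v = 144] the residues modulo 36 leave only [w = 6]
    and [w = 18], which are not orders, while the next value [w = 42] exceeds [g = 34]. *)
Definition base_orders : seq nat :=
  [:: 0; 10; 22; 24; 28; 34; 36; 42; 46; 48; 52; 54; 58; 60; 64; 70; 72; 78;
      82; 84; 94; 96; 106; 108; 142; 144].

Lemma pent_order_base (v : nat) : v \in base_orders -> pent_order v.
Proof.
move=> vb; rewrite !inE in vb.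
do 25! [case/orP: vb => [/eqP ->|vb]; first by
  first [ exact: pent_order_0 | exact: pent_order_10 | exact: pent_order_22
        | exact: pent_order_24 | exact: pent_order_28 | exact: pent_order_34
        | exact: pent_order_36 | exact: pent_order_42 | exact: pent_order_46
        | exact: pent_order_48 | exact: pent_order_52 | exact: pent_order_54
        | exact: pent_order_58 | exact: pent_order_60 | exact: pent_order_64
        | exact: pent_order_70 | exact: pent_order_72 | exact: pent_order_78
        | exact: pent_order_82 | exact: pent_order_84 | exact: pent_order_94
        | exact: pent_order_96 | exact: pent_order_106 | exact: pent_order_108
        | exact: pent_order_142 ]].
by move/eqP: vb => ->; exact: pent_order_144.
Qed.

Definition admissible (v : nat) : bool :=
  (v == 0) || [&& v %% 6 \in [:: 0; 4], 10 <= v & v \notin [:: 12; 16; 18]].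

Definition splits (v w : nat) : bool :=
  let g := (v - w) %/ 3 in
  [&& 3 * g + w == v, g %% 4 == 2, 2 < g, w <= g, admissible g & admissible w].

Lemma splits_small (v : nat) : v < 216 -> admissible v -> v \notin base_orders ->
  has (splits v) [:: 0; 10; 22; 24; 28; 30; 40; 42].
Proof.
have all_split : all (fun v => admissible v ==> (v \notin base_orders) ==>
  has (splits v) [:: 0; 10; 22; 24; 28; 30; 40; 42]) (iota 0 216) by vm_compute.
move=> v216 va vb; have := allP all_split v; rewrite mem_iota va vb; exact.
Qed.

(* (v - w) / 3 must be 6 or 10 mod 12, that is v - w = 18 or 30 mod 36. *)
Definition tail_size (v : nat) : nat :=
  nth 0 [:: 42; 0; 0; 0; 22; 0; 24; 0; 0; 0; 28; 0; 30; 0; 0; 0; 22; 0; 0; 0;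
            0; 0; 28; 0; 30; 0; 0; 0; 10; 0; 0; 0; 0; 0; 40] (v %% 36).

(** The tail is at most 42, so [g] is at least [(216 - 42) / 3 = 58]: it exceeds both the tail and
    the exceptional orders. *)
Lemma splits_large (v : nat) : 216 <= v -> admissible v -> splits v (tail_size v).
Proof.
move=> v216; rewrite /admissible !inE => va.
have : v %% 36 \in [:: 0; 4; 6; 10; 12; 16; 18; 22; 24; 28; 30; 34].
  rewrite !inE; lia.
rewrite /splits /tail_size !inE /admissible.
by do 11![case/orP => [/eqP E|]; first by rewrite E /= !inE; lia];
  move/eqP => E; rewrite E /= !inE; lia.
Qed.

Lemma pent_order_admissible (v : nat) : admissible v -> pent_order v.
Proof.
elim/ltn_ind: v => v IH va.
have step w : splits v w -> pent_order v.
  case/and5P => /eqP vE /eqP g4 g2 wg /andP[ga wa].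
  move: vE g4 g2 wg ga; set g := (_ - _) %/ 3 => vE g4 g2 wg ga.
  rewrite -vE; apply: pent_order_3gw => //.
  - by move: wa; rewrite /admissible !inE; lia.
  - by apply: IH => //; lia.
  - by apply: IH => //; lia.
have [|nb] := boolP (v \in base_orders); first exact: pent_order_base.
have [v216|v216] := ltnP v 216; last exact: step (splits_large v216 va).
by have /hasP[w _] := splits_small v216 va nb; exact: step.
Qed.

Lemma exists_pent3 (r : nat) : 0 < r -> r %% 3 = 0 \/ r %% 3 = 1 ->
  r \notin [:: 1; 4; 6; 7] -> exists_pent_with_best_code 3 r.
Proof.
move=> r_gt0 r3 rn; apply: pent_order_geometry => //.
by apply: pent_order_admissible; move: rn; rewrite /admissible !inE; lia.
Qed.

(** * Exhaustive search for cubic graphs *)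

Fixpoint bor (s1 s2 : bitseq) : bitseq :=
  match s1, s2 with
  | [::], _ => s2
  | _, [::] => s1
  | b1 :: s1', b2 :: s2' => (b1 || b2) :: bor s1' s2'
  end.

(** The set of vertices adjacent to a member of [X]. Sets are bit sequences, with bits beyond the
    end read as [false]. *)
Fixpoint bstep (A : seq bitseq) (X : bitseq) : bitseq :=
  match A, X with
  | r :: A', b :: X' => if b then bor r (bstep A' X') else bstep A' X'
  | _, _ => [::]
  end.

Definition row (A : seq bitseq) (i : nat) : bitseq := nth [::] A i.
Definition edge (A : seq bitseq) (i j : nat) : bool := nth false (row A i) j.

Definition add_arc (A : seq bitseq) (i j : nat) : seq bitseq :=
  set_nth [::] A i (set_nth false (row A i) j true).
Definition add_edge (A : seq bitseq) (i j : nat) : seq bitseq :=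
  add_arc (add_arc A i j) j i.

Definition degree (A : seq bitseq) (i : nat) : nat :=
  count (edge A i) (iota 0 (size A)).

Lemma nth_bor (s1 s2 : bitseq) (j : nat) :
  nth false (bor s1 s2) j = nth false s1 j || nth false s2 j.
Proof.
elim: s1 s2 j => [|b1 s1 IH] [|b2 s2] [|j] //=; rewrite ?orbF //.
Qed.

(** This direction is what soundness rests on: a bit that is set comes from a walk of recorded
    edges, hence from a walk in the ambient graph. *)
Lemma nth_bstep (A : seq bitseq) (X : bitseq) (j : nat) :
  nth false (bstep A X) j -> exists2 i, nth false X i & edge A i j.
Proof.
elim: A X => [|r A IH] [|b X] //=; rewrite ?nth_nil //.
have shift : nth false (bstep A X) j ->
    exists2 i, nth false (b :: X) i & edge (r :: A) i j.
  by case/IH => i Xi Aij; exists i.+1.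
by case: b shift => // shift; rewrite nth_bor => /orP[rj|/shift //]; exists 0.
Qed.

Lemma edge_add_edge (A : seq bitseq) (i j a b : nat) :
  edge (add_edge A i j) a b =
    [|| edge A a b, (a == i) && (b == j) | (a == j) && (b == i)].
Proof.
have arc B c d : edge (add_arc B c d) a b = edge B a b || (a == c) && (b == d).
  rewrite /edge /add_arc /row nth_set_nth /=; case: eqVneq => [->|] /=.
    by rewrite nth_set_nth /=; case: eqVneq; rewrite ?orbT ?orbF.
  by rewrite orbF.
by rewrite !arc orbA.
Qed.

Lemma size_add_edge (A : seq bitseq) (i j : nat) : i < size A ->
  size (add_edge A i j) = maxn j.+1 (size A).
Proof.
move=> iA; rewrite /add_edge /add_arc !size_set_nth; lia.
Qed.

(* A partial graph is closed off either by a set W of vertices with too few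
   distant pairs, or by completing the neighbourhood of vertex i in all possible
   ways. *)
Inductive refutation : Type :=
  | Cut of seq nat
  | Split of nat & seq refutation.

(** * Extensions of a partial graph to a cubic graph *)

Section Search.

Variables (v d B : nat) (pentagon_free : bool).

(** The ends of walks of length 1, 2 and 3 from [i], and of length 4 in the pentagon-free case.
    Joining [i] to one of them would repeat an edge or close a triangle, a square or a pentagon. *)
Definition blocked (A : seq bitseq) (i : nat) : bitseq :=
  let r1 := row A i in
  let r2 := bstep A r1 in
  let r3 := bstep A r2 in
  bor r1 (bor r2 (if pentagon_free then bor r3 (bstep A r3) else r3)).

Definition candidates (A : seq bitseq) (i lo : nat) : seq nat :=
  let bl := blocked A i in
  [seq j <- iota lo (size A - lo) |
    [&& ~~ nth false bl j, j != i & degree A j < 3]].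

(** The [k] missing edges at [i] go first to old vertices, in increasing order thanks to [lo], and
    the rest to new vertices. New vertices are interchangeable, so they need a single branch, which
    requires room among the [v] points. *)
Fixpoint completions (k : nat) (A : seq bitseq) (i lo : nat) : seq (seq bitseq) :=
  if k is k'.+1 then
    flatten [seq completions k' (add_edge A i j) i j.+1 | j <- candidates A i lo]
    ++ (if size A + k <= v
        then [:: iter k (fun A' => add_edge A' i (size A')) A] else [::])
  else [:: A].

(** [d] is the number of far lines through a point and [B] the number of all far lines. The sum runs
    over ordered pairs, which explains the factors 2. *)
Definition cut_ok (A : seq bitseq) (W : seq nat) : bool :=
  let far a := let nf := bor (row A a) (bstep A (row A a)) in
    count (fun b => (b != a) && ~~ nth false nf b) W in
  [&& uniq W, all (fun a => a < size A) W &
      sumn (map far W) + 2 * B < 2 * d * size W].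

(** The certificates of a [Split] are matched one by one with the completions; hence [Split i [::]]
    claims that the neighbourhood of [i] cannot be completed at all. *)
Fixpoint refutes (A : seq bitseq) (c : refutation) : bool :=
  match c with
  | Cut W => cut_ok A W
  | Split i cs =>
      (i < size A) && (fix all2r As cs {struct cs} :=
        match As, cs with
        | [::], [::] => true
        | A' :: As', c' :: cs' => refutes A' c' && all2r As' cs'
        | _, _ => false
        end) (completions (3 - degree A i) A i 0) cs
  end.

Variables (V : finType) (x0 : V) (e : rel V).
Hypotheses (e_sym : symmetric e) (e_irr : irreflexive e)
  (cubic : forall x, #|[set y | e x y]| = 3)
  (no_triangle : forall x y z, e x y -> e y z -> ~~ e z x)
  (no_square : forall x y a b, e x a -> e x b -> e y a -> e y b -> x != y -> a = b)
  (no_pentagon : pentagon_free -> forall a b c f g,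
     e a b -> e b c -> e c f -> e f g -> ~~ e g a)
  (cardV : #|V| = v).

Definition far (x y : V) : bool :=
  [&& x != y, ~~ e x y & [forall z, ~~ (e x z && e z y)]].

Hypothesis few_far : forall W : {set V},
  2 * d * #|W| <= \sum_(x in W) #|[set y in W | far x y]| + 2 * B.

(** The points of [s] may have further edges among them that [A] does not record, so a missing
    neighbour of an old vertex can itself be old. *)
Definition embeds (s : seq V) (A : seq bitseq) : Prop :=
  [/\ uniq s, size A = size s &
      forall i j, edge A i j -> [/\ i < size s, j < size s, edge A j i &
        e (nth x0 s i) (nth x0 s j)]].

Definition mapped (s : seq V) (A : seq bitseq) (i : nat) : {set V} :=
  [set x in [seq nth x0 s k | k <- iota 0 (size A) & edge A i k]].

Definition missing (s : seq V) (A : seq bitseq) (i : nat) : {set V} :=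
  [set y | e (nth x0 s i) y] :\: mapped s A i.

Section Embedded.

Variables (s : seq V) (A : seq bitseq).
Hypothesis emb : embeds s A.

Lemma mem_mapped i k : k < size s -> (nth x0 s k \in mapped s A i) = edge A i k.
Proof.
case: emb => un szA eA ks; rewrite inE; apply/mapP/idP => [[l]|Aik].
  rewrite mem_filter mem_iota szA => /andP[Ail /= ls] /eqP.
  by rewrite nth_uniq // => /eqP ->.
by exists k; rewrite // mem_filter Aik mem_iota szA.
Qed.

Lemma card_mapped i : #|mapped s A i| = degree A i.
Proof.
case: emb => un szA eA; rewrite cardsE (card_uniqP _); first
  by rewrite size_map size_filter.
rewrite map_inj_in_uniq ?filter_uniq ?iota_uniq // => k l.
rewrite !mem_filter !mem_iota szA => /andP[_ /= ks] /andP[_ ls] /eqP.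
by rewrite nth_uniq // => /eqP.
Qed.

Lemma mapped_sub i : mapped s A i \subset [set y | e (nth x0 s i) y].
Proof.
case: emb => un szA eA; apply/subsetP => y; rewrite !inE => /mapP[k].
by rewrite mem_filter => /andP[/eA[_ _ _ ?] _] ->.
Qed.

Lemma card_missing i : #|missing s A i| = 3 - degree A i.
Proof.
by rewrite cardsD (setIidPr (mapped_sub i)) cubic card_mapped.
Qed.

Lemma mem_missing i k : k < size s ->
  (nth x0 s k \in missing s A i) = e (nth x0 s i) (nth x0 s k) && ~~ edge A i k.
Proof. by move=> ks; rewrite !inE -[_ \in map _ _]inE mem_mapped // andbC. Qed.

Lemma missing_unblocked i j : i < size s -> j < size s ->
  nth x0 s j \in missing s A i -> ~~ nth false (blocked A i) j.
Proof.
case: (emb) => un szA eA is_ js; rewrite mem_missing // => /andP[eij nAij].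
have step X a : nth false (bstep A X) a -> exists2 b, nth false X b & edge A b a.
  exact: nth_bstep.
rewrite /blocked !nth_bor; apply/negP => /or3P[/= Aij|/step[a Aia Aaj]|].
- by rewrite [edge A i j]Aij in nAij.
- have [_ _ _ eia] := eA _ _ Aia; have [_ _ _ eaj] := eA _ _ Aaj.
  by move: (no_triangle eia eaj); rewrite e_sym eij.
have r3 : ~ nth false (bstep A (bstep A (row A i))) j.
  move=> /step[b /step[a Aia Aab] Abj].
  have [_ as_ _ eia] := eA _ _ Aia; have [_ bs _ eab] := eA _ _ Aab.
  have [_ _ _ ebj] := eA _ _ Abj.
  (* A backtracking walk would make [i j] a recorded edge; otherwise the walk closes a genuine
     square. *)
  have ib : nth x0 s i != nth x0 s b.
    by rewrite nth_uniq //; apply: contraNneq nAij => ->.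
  rewrite e_sym in eab; have /eqP := no_square eia eij eab ebj ib.
  by rewrite nth_uniq // => /eqP aj; move: nAij; rewrite -aj [edge A i a]Aia.
case: (boolP pentagon_free) => // pf; rewrite nth_bor => /orP[//|].
move=> /step[c /step[b /step[a Aia Aab] Abc] Acj].
have [_ _ _ eia] := eA _ _ Aia; have [_ _ _ eab] := eA _ _ Aab.
have [_ _ _ ebc] := eA _ _ Abc; have [_ _ _ ecj] := eA _ _ Acj.
by move: (no_pentagon pf eia eab ebc ecj); rewrite e_sym eij.
Qed.

Lemma missing_candidate i j lo : i < size s -> j < size s -> lo <= j ->
  nth x0 s j \in missing s A i -> j \in candidates A i lo.
Proof.
move=> is_ js loj jm; rewrite mem_filter missing_unblocked //=.
case: (emb) => un szA eA; move: (jm); rewrite mem_missing // => /andP[eij nAij].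
rewrite mem_iota loj subnKC ?szA ?js ?(ltnW (leq_ltn_trans loj js)) // !andbT.
apply/andP; split; first by apply: contraTneq eij => ->; rewrite e_irr.
(* The point of [i] is a neighbour of the point of [j] that is not recorded, so fewer than three
   are. *)
rewrite -card_mapped -(cubic (nth x0 s j)); apply: proper_card.
rewrite properE mapped_sub; apply/subsetPn; exists (nth x0 s i).
  by rewrite inE e_sym.
by rewrite mem_mapped //; apply: contra nAij => /eA[].
Qed.

Lemma embeds_old i j : i < size s -> j < size s ->
  e (nth x0 s i) (nth x0 s j) -> embeds s (add_edge A i j).
Proof.
case: emb => un szA eA is_ js eij; split=> //.
  by rewrite size_add_edge szA //; lia.
move=> a b; rewrite !edge_add_edge.
case/or3P => [/eA[-> -> ->]|/andP[/eqP -> /eqP ->]|/andP[/eqP -> /eqP ->]] //.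
  by rewrite !eqxx !orbT.
by rewrite !eqxx !orbT e_sym.
Qed.

Lemma missing_add i j : i < size s -> j < size s ->
  e (nth x0 s i) (nth x0 s j) ->
  missing s (add_edge A i j) i = missing s A i :\ nth x0 s j.
Proof.
case: (emb) => un szA eA is_ js eij.
have ij : i != j by apply: contraTneq eij => ->; rewrite e_irr.
apply/setP => y; rewrite !inE.
have -> : (y \in [seq nth x0 s k | k <- iota 0 (size (add_edge A i j)) &
             edge (add_edge A i j) i k]) =
          (y == nth x0 s j) ||
          (y \in [seq nth x0 s k | k <- iota 0 (size A) & edge A i k]).
  have -> : size (add_edge A i j) = size A by rewrite size_add_edge szA //; lia.
  apply/mapP/idP => [[k]|/orP[/eqP ->|/mapP[k kA ->]]].
  - rewrite mem_filter edge_add_edge eqxx (negbTE ij) /= orbF.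
    move=> /andP[/orP[Aik|/eqP ->] kA] ->.
      by apply/orP; right; apply: map_f; rewrite mem_filter Aik.
    by rewrite eqxx.
  - by exists j; rewrite // mem_filter edge_add_edge !eqxx orbT mem_iota szA.
  - exists k => //; move: kA; rewrite !mem_filter edge_add_edge => /andP[-> ->] //.
by rewrite negb_or andbA.
Qed.

Lemma embeds_new i y : i < size s -> y \notin s -> e (nth x0 s i) y ->
  embeds (rcons s y) (add_edge A i (size A)).
Proof.
case: emb => un szA eA is_ ys eiy.
have last_y : nth x0 (rcons s y) (size s) = y by rewrite nth_rcons ltnn eqxx.
have old k : k < size s -> nth x0 (rcons s y) k = nth x0 s k.
  by move=> ks; rewrite nth_rcons ks.
split; rewrite ?rcons_uniq ?ys ?size_rcons //.
  by rewrite size_add_edge szA //; lia.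
move=> a b; rewrite !edge_add_edge szA.
case/or3P => [/eA[as_ bs -> eab]|/andP[/eqP -> /eqP ->]|/andP[/eqP -> /eqP ->]].
- by rewrite !old // !ltnS (ltnW as_) (ltnW bs).
- by rewrite !eqxx !orbT last_y old // !ltnS (ltnW is_) leqnn.
- by rewrite !eqxx !orbT last_y old // e_sym !ltnS (ltnW is_) leqnn.
Qed.

End Embedded.

Lemma embeds_news s A i ys : embeds s A -> i < size s ->
    uniq ys -> all (e (nth x0 s i)) ys -> all [predC s] ys ->
  embeds (s ++ ys) (iter (size ys) (fun A' => add_edge A' i (size A')) A).
Proof.
elim/last_ind: ys => [|ys y IH] emb is_; first by rewrite cats0.
rewrite rcons_uniq !all_rcons => /andP[yys un] /andP[ey eys] /andP[ys_ ns].
rewrite size_rcons iterS -rcons_cat; apply: embeds_new; first exact: IH.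
- by rewrite size_cat ltn_addr.
- by rewrite mem_cat negb_or yys andbT.
- by rewrite nth_cat is_.
Qed.

Lemma completions_sound s i k A lo : embeds s A -> i < size s ->
    #|missing s A i| = k ->
    (forall j, j < size s -> nth x0 s j \in missing s A i -> lo <= j) ->
  exists2 A', A' \in completions k A i lo & exists s', embeds s' A'.
Proof.
elim: k A lo => [|k IH] A lo emb is_ kE lo_min.
  by exists A; rewrite ?inE //; exists s.
case: (boolP (has (fun j => nth x0 s j \in missing s A i) (iota 0 (size s)))) => [|nonew].
  move=> hj; have exj : exists j, (j < size s) && (nth x0 s j \in missing s A i).
    by case/hasP: hj => j; rewrite mem_iota add0n => /= js jm; exists j; rewrite js.
  (* The smallest old missing neighbour is taken, in agreement with the increasing order in
     [completions]. *)
  case: (ex_minnP exj) => j /andP[js jm] jmin.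
  have eij : e (nth x0 s i) (nth x0 s j) by move: jm; rewrite mem_missing // => /andP[].
  have [||||A' A'c s'A'] := IH (add_edge A i j) j.+1.
  - exact: embeds_old.
  - by [].
  - have := cardsD1 (nth x0 s j) (missing s A i).
    by rewrite jm kE missing_add // add1n => -[].
  - move=> l ls; rewrite missing_add // in_setD1 nth_uniq //; last by case: emb.
    case/andP => lj lm; rewrite ltn_neqAle eq_sym lj; apply: jmin.
    by rewrite ls.
  exists A' => //=; rewrite mem_cat; apply/orP; left.
  apply/flattenP; exists (completions k (add_edge A i j) i j.+1) => //.
  apply/mapP; exists j => //.
  exact: missing_candidate (lo_min j js jm) jm.
pose ys := enum (missing s A i).
have ysk : size ys = k.+1 by rewrite -cardE.
have news : embeds (s ++ ys) (iter k.+1 (fun A' => add_edge A' i (size A')) A).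
  rewrite -ysk; apply: embeds_news => //; rewrite ?enum_uniq //.
    by apply/allP => y; rewrite mem_enum !inE => /andP[].
  apply/allP => y; rewrite mem_enum => ym; apply/negP => /= ys_.
  case/negP: nonew; apply/hasP; exists (index y s); last by rewrite nth_index.
  by rewrite mem_iota /= index_mem.
exists (iter k.+1 (fun A' => add_edge A' i (size A')) A); last by exists (s ++ ys).
rewrite /= mem_cat; apply/orP; right; case: news => un _ _; case: (emb) => _ -> _.
by rewrite -ysk -size_cat -cardV -(card_uniqP un) max_card ?inE ?eqxx.
Qed.

(** Vertices within recorded distance 2 are within distance 2 in the ambient graph, so the count in
    [cut_ok] is an upper bound for the far pairs inside [W]. *)
Lemma cut_sound s A W : embeds s A -> ~~ cut_ok A W.
Proof.
move=> emb; case: (emb) => un szA eA; apply/negP => /and3P[unW /allP Wlt].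
rewrite ltnNge => /negP; apply; pose ws := [seq nth x0 s a | a <- W].
have lt_s a : a \in W -> a < size s by move/Wlt; rewrite szA.
have unws : uniq ws.
  rewrite map_inj_in_uniq // => a b /lt_s al /lt_s bl /eqP.
  by rewrite nth_uniq // => /eqP.
have := few_far [set x in ws]; rewrite cardsE (card_uniqP unws) size_map.
move=> le; apply: leq_trans le _; rewrite leq_add2r.
rewrite (eq_bigl (mem ws)) => [|x]; last by rewrite inE.
rewrite -big_uniq //= big_map sumnE big_map big_seq [leqRHS]big_seq.
apply: leq_sum => a aW; set nf := bor _ _.
pose near b := (b != a) && ~~ nth false nf b.
apply: leq_trans (_ : size [seq nth x0 s b | b <- W & near b] <= _); last first.
  by rewrite size_map size_filter.
apply: leq_trans (card_size _); apply: subset_leq_card; apply/subsetP => y.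
rewrite !inE => /andP[/mapP[b bW ->] /and3P[sab nab /forallP nz]].
apply: map_f; rewrite mem_filter bW andbT /near; apply/andP; split.
  by apply: contraNneq sab => ->.
rewrite nth_bor negb_or; apply/andP; split.
  by apply: contra nab => /eA[].
apply/negP => /nth_bstep[c /eA[_ _ _ eac] /eA[_ _ _ ecb]].
by move: (nz (nth x0 s c)); rewrite eac ecb.
Qed.

Lemma refutes_sound c s A : embeds s A -> ~~ refutes A c.
Proof.
move: c s A; fix IH 1 => -[W|i cs] s A emb; first exact: cut_sound emb.
apply/negP => /= /andP[iA]; move: (iA); case: (emb) => _ -> _ is_.
have [A' + [s' emb']] :=
  completions_sound emb is_ (card_missing emb i) (fun _ _ _ => leq0n _).
elim: cs (completions _ _ _ _) => [|c cs IHcs] [|A1 As] //.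
rewrite inE => /orP[/eqP <-|A'As] /andP[r1 rs].
  exact: (negP (IH c s' A' emb')) r1.
exact: IHcs A'As rs.
Qed.

End Search.

(** * Necessary conditions on the deficiency graph *)

Section Deficiency.

Variables (T : finType) (L : {set {set T}}) (r : nat) (S : {set T}).
Hypotheses (geom : pentagonal_geometry 3 r L) (r_gt0 : 0 < r).
Hypothesis code : identifying_code (deficiency_graph L) S.

Let e := deficiency_graph L.

Lemma deficiency_sym : symmetric e.
Proof.
move=> x y; rewrite /e /deficiency_graph; congr (~~ _).
by apply: eq_existsb => l; rewrite [(y \in l) && _]andbC.
Qed.

Lemma deficiency_irr : irreflexive e.
Proof.
move=> x; apply/negbF; have : 0 < #|[set l in L | x \in l]|.
  by rewrite (pent_point_degree geom).
rewrite card_gt0 => /set0Pn[l]; rewrite inE => /andP[lL xl].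
by apply/exists_inP; exists l; rewrite ?xl.
Qed.

Lemma nbhd_line_mem x : nbhd e x \in L.
Proof. exact: pent_opposite_line geom x. Qed.

Lemma deficiency_cubic x : #|[set y | e x y]| = 3.
Proof. by apply: (pent_line_size geom); exact: nbhd_line_mem. Qed.

Lemma nbhd_inj : injective (nbhd e).
Proof. by move=> x y nxy; apply: code; rewrite -/e nxy. Qed.

Lemma collinear_not_deficient l x y : l \in L -> x \in l -> y \in l -> ~~ e x y.
Proof.
by move=> lL xl yl; rewrite negbK; apply/exists_inP; exists l; rewrite ?xl.
Qed.

Lemma deficiency_no_triangle x y z : e x y -> e y z -> ~~ e z x.
Proof.
move=> xy yz; apply: (collinear_not_deficient (nbhd_line_mem y)); rewrite inE //.
by rewrite deficiency_sym.
Qed.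

(** Two lines, the neighbourhoods of [x] and [y], would share the distinct points [a] and [b]. *)
Lemma deficiency_no_square x y a b :
  e x a -> e x b -> e y a -> e y b -> x != y -> a = b.
Proof.
move=> xa xb ya yb xy; apply/eqP/negPn/negP => ab; case/eqP: xy; apply: nbhd_inj.
by apply: (pent_pls geom ab); rewrite ?nbhd_line_mem ?inE.
Qed.

Lemma pent_card : #|T| = 2 * r + 4.
Proof.
have [x _] : exists x : T, x \in T by apply/card_gt0P; exact: pent_nonempty geom.
have := star_card x (pent_pls geom) (pent_line_size geom).
rewrite (pent_point_degree geom).
have -> : [set y | (y != x) && collinear L x y] = ~: (x |: [set y | e x y]).
  by apply/setP => y; rewrite !inE negb_or negbK.
have := cardsC (x |: [set y | e x y]).
rewrite cardsU1 inE deficiency_irr deficiency_cubic /=.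
by move: #|pred_of_set (~: _)| => n; lia.
Qed.

(** * Counting on far lines *)

(** Flags with their point in [W], weighted by [n] and counted by lines and by points. The weight 1
    counts flags; the weight [#|l :&: W|] counts ordered pairs of points of [W] on a common line. *)
Lemma sum_incidence (F : {set {set T}}) (W : {set T}) (n : {set T} -> nat) :
  \sum_(l in F) n l * #|l :&: W| =
  \sum_(x in W) \sum_(l in [set l in F | x \in l]) n l.
Proof.
rewrite (exchange_big_dep (mem F)) /= => [|x l _]; last by rewrite inE => /andP[].
apply: eq_bigr => l lF; rewrite mulnC sum_nat_const; congr (_ * _).
by apply: eq_card => x; rewrite inE [RHS]unfold_in /= inE lF andbC.
Qed.

Definition opposite_lines : {set {set T}} := [set nbhd e x | x : T].
Definition far_lines : {set {set T}} := L :\: opposite_lines.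

(** Counting flags gives [3 * #|L| = #|T| * r], and exactly [#|T|] of the lines are
    neighbourhoods. *)
Lemma card_far_lines : 3 * (#|far_lines| + #|T|) = #|T| * r.
Proof.
have <- : #|opposite_lines| = #|T| by rewrite card_imset //; exact: nbhd_inj.
have sub : opposite_lines \subset L.
  by apply/subsetP => _ /imsetP[x _ ->]; exact: nbhd_line_mem.
rewrite {2}[#|opposite_lines|]card_imset; last exact: nbhd_inj.
rewrite addnC -{1}(setIidPr sub) cardsID.
have := sum_incidence L setT (fun=> 1).
under eq_bigr => l lL do rewrite mul1n setIT (pent_line_size geom lL).
rewrite sum_nat_const mulnC => ->.
under eq_bigr => x _ do rewrite sum1_card (pent_point_degree geom).
by rewrite sum_nat_const cardsT.
Qed.

(** The neighbourhoods that contain [x] are those of its three neighbours. *)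
Lemma far_degree x : #|[set l in far_lines | x \in l]| = r - 3.
Proof.
have := cardsID opposite_lines [set l in L | x \in l].
rewrite (pent_point_degree geom).
have -> : [set l in L | x \in l] :\: opposite_lines = [set l in far_lines | x \in l].
  by apply/setP => l; rewrite !inE andbA.
have -> : [set l in L | x \in l] :&: opposite_lines = nbhd e @: nbhd e x.
  apply/setP => l; rewrite !inE; apply/idP/imsetP.
    case/andP => /andP[_ xl] /imsetP[y _ lE]; exists y => //.
    by move: xl; rewrite lE !inE deficiency_sym.
  case=> y xy ->; rewrite nbhd_line_mem imset_f // !inE deficiency_sym andbT.
  by rewrite inE in xy.
rewrite card_imset; last exact: nbhd_inj.
by rewrite deficiency_cubic; lia.
Qed.

(** A common neighbour [z] of two points of a far line would make this line share two points with
    the neighbourhood of [z], hence equal it. *)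
Lemma far_pair_lines x y : x != y ->
  #|[set l in far_lines | (x \in l) && (y \in l)]| <= far e x y.
Proof.
move=> xy; case: (set_0Vmem [set l in far_lines | (x \in l) && (y \in l)]) => [->|[l]].
  by rewrite cards0.
rewrite inE => /andP[lF /andP[xl yl]].
have [lL lO] : l \in L /\ l \notin opposite_lines.
  by move: lF; rewrite inE => /andP[].
have -> : far e x y.
  rewrite /far xy (collinear_not_deficient lL xl yl) /=; apply/forallP => z.
  apply/negP => /andP[exz ezy]; case/negP: lO; apply/imsetP; exists z => //.
  by apply: (pent_pls geom xy lL (nbhd_line_mem z)); rewrite ?inE // deficiency_sym.
rewrite (_ : [set _ in _ | _] = [set l]) ?cards1 //; apply/setP => m.
rewrite !inE; apply/idP/eqP => [|->].
  by case/andP => /andP[_ mL] /andP[xm ym]; apply: (pent_pls geom xy).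
by rewrite lO lL xl yl.
Qed.

Lemma few_far_pairs (W : {set T}) :
  2 * (r - 3) * #|W| <=
    \sum_(x in W) #|[set y in W | far e x y]| + 2 * #|far_lines|.
Proof.
have flags : \sum_(l in far_lines) #|l :&: W| = #|W| * (r - 3).
  have := sum_incidence far_lines W (fun=> 1).
  under eq_bigr => l _ do rewrite mul1n.
  move=> ->; under eq_bigr => x _ do rewrite sum1_card far_degree.
  by rewrite sum_nat_const.
(* The sum of squares counts ordered pairs of points of [W] on a far line; the pairs with equal
   entries are the [#|W| * (r - 3)] flags. *)
have pairs : \sum_(l in far_lines) #|l :&: W| * #|l :&: W| <=
    #|W| * (r - 3) + \sum_(x in W) #|[set y in W | far e x y]|.
  rewrite (sum_incidence _ _ (fun l => #|l :&: W|)) -sum_nat_const -big_split /=.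
  apply: leq_sum => x xW.
  have := sum_incidence [set l in far_lines | x \in l] W (fun=> 1).
  under eq_bigr => l _ do rewrite mul1n.
  move=> ->; rewrite (bigD1 x xW) /= sum1_card.
  rewrite (_ : [set l in _ | _] = [set l in far_lines | x \in l]); last first.
    by apply/setP => l; rewrite !inE -andbA andbb.
  rewrite far_degree leq_add2l -sum1_card [leqRHS]big_mkcond /=.
  rewrite (eq_bigl (fun y => (y \in W) && (y != x))) // [leqLHS]big_mkcond /=.
  apply: leq_sum => y _; rewrite inE; case: (y \in W) => //=.
  case: eqVneq => //= yx; rewrite sum1_card.
  rewrite (_ : [set l in _ | _] = [set l in far_lines | (x \in l) && (y \in l)]).
    by apply: leq_trans (far_pair_lines _) _; rewrite 1?eq_sym //; case: far.
  by apply/setP => l; rewrite !inE -!andbA.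
(* With [s = #|l :&: W|], each line contributes [3 s <= s * s + 2]. *)
have : 3 * \sum_(l in far_lines) #|l :&: W| <=
    \sum_(l in far_lines) #|l :&: W| * #|l :&: W| + 2 * #|far_lines|.
  rewrite big_distrr /= mulnC -sum_nat_const -big_split /=; apply: leq_sum => l _.
  by case: #|_| => [|[|[|k]]] //; nia.
rewrite flags; move: pairs.
move: (\sum_(l in _) _) (\sum_(x in _) _) => p f; lia.
Qed.

End Deficiency.

(** * Nonexistence *)

(** The certificates are named after the number of points: 6, 12, 16 and 18 belong to [r] = 1, 4, 6
    and 7. *)
Definition refutation6_pentagon : refutation :=
  Split 0 [:: Split 1 [::]].

Definition refutation6 : refutation :=
  Split 0 [:: Split 1 [:: Split 2 [::]]].

(** Here [d = 1] and [B = 4]. A pentagon contains no far pair, although the inequality demands at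
    least [5 - 4 = 1]. *)
Definition refutation12_pentagon : refutation :=
  Split 0 [:: Cut [:: 0; 1; 2; 3; 4]].

Definition refutation12 : refutation :=
  Split 0 [:: Split 1 [:: Split 2 [:: Split 3 [:: Split 4 [:: Split 5 [::]]]]]].

(** Here [d = 3] and [B = 16]: a set of 8 points must contain at least 8 far pairs, a set of 9
    points at least 11. *)
Definition refutation16_pentagon : refutation :=
  Split 0 [:: Split 1 [:: Split 2 [:: Split 3 [:: Split 5 [:: Cut [:: 0; 1; 2;
  3; 4; 5; 6; 7; 8]; Cut [:: 0; 1; 2; 3; 4; 5; 7; 9]; Cut [:: 0; 1; 2; 3; 4; 5;
  8; 9]; Split 6 [:: Cut [:: 0; 1; 2; 3; 4; 5; 6; 9]; Cut [:: 0; 1; 2; 3; 4; 5;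
  6; 10]; Cut [:: 0; 1; 2; 3; 4; 5; 6]; Cut [:: 0; 1; 2; 3; 4; 5; 6; 9]; Cut
  [:: 0; 1; 2; 3; 4; 5; 6; 10]; Split 7 [:: Cut [:: 0; 1; 2; 3; 4; 5; 7; 9];
  Cut [:: 0; 1; 2; 3; 4; 5; 7; 9]; Cut [:: 0; 1; 2; 3; 4; 5; 7; 9]; Cut [:: 0;
  1; 2; 3; 4; 5; 7; 10]; Cut [:: 0; 1; 2; 3; 4; 5; 7; 10]; Cut [:: 0; 1; 2; 3;
  4; 5; 7; 10]; Cut [:: 0; 1; 2; 3; 4; 6; 7; 11]; Cut [:: 0; 1; 2; 3; 4; 6; 7;
  12]; Split 4 [:: Cut [:: 0; 1; 2; 3; 4; 5; 6; 11]; Cut [:: 0; 1; 2; 3; 4; 5;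
  6; 12]; Cut [:: 0; 1; 2; 3; 4; 5; 13]; Cut [:: 0; 1; 2; 3; 4; 5; 14]; Split 8
  [:: Cut [:: 0; 1; 2; 3; 4; 6; 8; 11]; Cut [:: 0; 1; 2; 3; 4; 6; 8; 12]; Cut
  [:: 0; 1; 2; 3; 4; 7; 8; 13]; Cut [:: 0; 1; 2; 3; 4; 7; 8; 14]; Cut [:: 0; 1;
  2; 3; 4; 6; 8; 11]; Cut [:: 0; 1; 2; 3; 4; 6; 8; 12]; Cut [:: 0; 1; 2; 3; 4;
  7; 8; 13]; Cut [:: 0; 1; 2; 3; 4; 7; 8; 14]; Cut [:: 0; 1; 2; 3; 4; 6; 8;
  11]; Cut [:: 0; 1; 2; 3; 4; 6; 8; 11]; Cut [:: 0; 1; 2; 3; 4; 6; 8; 12]; Cut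
  [:: 0; 1; 2; 3; 4; 6; 8; 12]]]]]]]]]].

Definition refutation16 : refutation :=
  Split 0 [:: Split 1 [:: Split 2 [:: Split 3 [:: Split 4 [:: Split 6 [:: Split
  5 [:: Cut [:: 0; 1; 2; 4; 5; 6; 10; 12]; Split 10 [:: Cut [:: 0; 1; 2; 3; 4;
  6; 8; 10]; Cut [:: 0; 1; 2; 3; 4; 6; 9; 10]; Split 12 [:: Split 13 [::];
  Split 14 [::]; Split 13 [::]; Split 14 [::]]]]; Split 5 [:: Cut [:: 0; 1; 2;
  4; 5; 6; 11; 12]; Split 11 [:: Cut [:: 0; 1; 2; 3; 4; 6; 8; 11]; Cut [:: 0;
  1; 2; 3; 4; 6; 9; 11]; Split 12 [:: Split 13 [::]; Split 14 [::]; Split 13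
  [::]; Split 14 [::]]]]; Split 5 [:: Split 12 [:: Cut [:: 0; 1; 2; 3; 5; 6; 8;
  12]; Cut [:: 0; 1; 2; 3; 5; 6; 9; 12]; Split 13 [:: Split 10 [::]; Split 11
  [::]; Split 10 [::]; Split 11 [::]]]; Split 13 [:: Cut [:: 0; 1; 2; 3; 5; 6;
  8; 13]; Cut [:: 0; 1; 2; 3; 5; 6; 9; 13]; Split 12 [:: Split 10 [::]; Split
  11 [::]; Split 10 [::]; Split 11 [::]]]; Split 7 [:: Cut [:: 0; 1; 2; 4; 5;
  7; 10; 14]; Cut [:: 0; 1; 2; 4; 5; 7; 10; 15]; Cut [:: 0; 1; 2; 4; 5; 7; 11;
  14]; Cut [:: 0; 1; 2; 4; 5; 7; 11; 15]]]]]]]]].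

(** Here [d = 4] and [B = 24]: sets of 8, 9 and 10 points must contain at least 8, 12 and 16 far
    pairs. *)
Definition refutation18_pentagon : refutation :=
  Split 0 [:: Split 1 [:: Split 2 [:: Split 3 [:: Split 5 [:: Cut [:: 0; 1; 2;
  3; 4; 5; 6; 7; 8]; Cut [:: 0; 1; 2; 3; 4; 5; 6; 7; 9]; Cut [:: 0; 1; 2; 3; 4;
  5; 6; 8; 9]; Split 6 [:: Cut [:: 0; 1; 2; 3; 4; 5; 6; 9; 10]; Cut [:: 0; 1;
  2; 3; 4; 5; 6; 9; 10]; Cut [:: 0; 1; 2; 3; 4; 5; 6; 8]; Cut [:: 0; 1; 2; 3;
  4; 5; 6; 9]; Cut [:: 0; 1; 2; 3; 4; 5; 6; 10]; Split 7 [:: Cut [:: 0; 1; 2;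
  3; 4; 5; 7; 9]; Cut [:: 0; 1; 2; 3; 4; 5; 7; 9]; Cut [:: 0; 1; 2; 3; 4; 5; 7;
  9]; Cut [:: 0; 1; 2; 3; 4; 5; 7; 10]; Cut [:: 0; 1; 2; 3; 4; 5; 7; 10]; Cut
  [:: 0; 1; 2; 3; 4; 5; 7; 10]; Cut [:: 0; 1; 2; 3; 4; 6; 7; 11]; Cut [:: 0; 1;
  2; 3; 4; 6; 7; 12]; Split 4 [:: Cut [:: 0; 1; 2; 3; 4; 5; 6; 11]; Cut [:: 0;
  1; 2; 3; 4; 5; 6; 12]; Cut [:: 0; 1; 2; 3; 4; 5; 7; 13]; Cut [:: 0; 1; 2; 3;
  4; 5; 7; 14]; Split 8 [:: Cut [:: 0; 1; 2; 3; 4; 5; 8; 9]; Cut [:: 0; 1; 2;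
  3; 4; 5; 8; 9]; Cut [:: 0; 1; 2; 3; 4; 5; 8; 9]; Cut [:: 0; 1; 2; 3; 4; 5; 8;
  9]; Cut [:: 0; 1; 2; 3; 4; 5; 8; 9]; Cut [:: 0; 1; 2; 3; 4; 5; 8; 10]; Cut
  [:: 0; 1; 2; 3; 4; 5; 8; 10]; Cut [:: 0; 1; 2; 3; 4; 5; 8; 10]; Cut [:: 0; 1;
  2; 3; 4; 5; 8; 10]; Cut [:: 0; 1; 2; 3; 4; 5; 8; 10]; Cut [:: 0; 1; 2; 3; 4;
  6; 8; 11]; Cut [:: 0; 1; 2; 3; 4; 6; 8; 11]; Cut [:: 0; 1; 2; 3; 4; 6; 8;
  11]; Cut [:: 0; 1; 2; 3; 4; 6; 8; 12]; Cut [:: 0; 1; 2; 3; 4; 6; 8; 12]; Cut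
  [:: 0; 1; 2; 3; 4; 6; 8; 12]; Cut [:: 0; 1; 2; 3; 4; 7; 8; 13]; Cut [:: 0; 1;
  2; 3; 4; 7; 8; 14]; Split 15 [:: Cut [:: 0; 1; 2; 3; 4; 5; 6; 9; 15]; Cut [::
  0; 1; 2; 3; 4; 5; 6; 9; 15]; Cut [:: 0; 1; 2; 3; 4; 5; 9; 15]; Cut [:: 0; 1;
  2; 3; 4; 5; 9; 15]; Cut [:: 0; 1; 2; 3; 4; 5; 9; 15]; Cut [:: 0; 1; 2; 3; 4;
  5; 9; 15]; Cut [:: 0; 1; 2; 3; 4; 5; 6; 10; 15]; Cut [:: 0; 1; 2; 3; 4; 5; 6;
  10; 15]; Cut [:: 0; 1; 2; 3; 4; 5; 10; 15]; Cut [:: 0; 1; 2; 3; 4; 5; 10;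
  15]; Cut [:: 0; 1; 2; 3; 4; 5; 10; 15]; Cut [:: 0; 1; 2; 3; 4; 5; 10; 15];
  Cut [:: 0; 1; 2; 3; 4; 6; 11; 15]; Cut [:: 0; 1; 2; 3; 4; 6; 11; 15]; Cut [::
  0; 1; 2; 3; 4; 6; 11; 15]; Cut [:: 0; 1; 2; 3; 4; 6; 11; 15]; Cut [:: 0; 1;
  2; 3; 4; 6; 12; 15]; Cut [:: 0; 1; 2; 3; 4; 6; 12; 15]; Cut [:: 0; 1; 2; 3;
  4; 6; 12; 15]; Cut [:: 0; 1; 2; 3; 4; 6; 12; 15]; Cut [:: 0; 1; 2; 3; 4; 7;
  13; 15]; Cut [:: 0; 1; 2; 3; 4; 7; 13; 15]; Cut [:: 0; 1; 2; 3; 4; 7; 14;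
  15]; Cut [:: 0; 1; 2; 3; 4; 7; 14; 15]]]]]]]]]]].

Definition refutation18 : refutation :=
  Split 0 [:: Split 1 [:: Split 2 [:: Split 3 [:: Split 4 [:: Split 6 [:: Split
  5 [:: Cut [:: 0; 1; 2; 4; 5; 6; 10; 12]; Split 10 [:: Cut [:: 0; 1; 2; 3; 4;
  6; 8; 10]; Cut [:: 0; 1; 2; 3; 4; 6; 9; 10]; Split 7 [:: Cut [:: 0; 1; 2; 4;
  5; 7; 10; 11; 13]; Cut [:: 0; 1; 2; 4; 5; 7; 10; 11; 14]; Cut [:: 0; 1; 2; 4;
  6; 7; 10; 11]; Split 13 [:: Cut [:: 0; 1; 2; 3; 5; 7; 8; 13]; Cut [:: 0; 1;
  2; 3; 5; 7; 9; 13]; Cut [:: 0; 1; 2; 4; 5; 6; 7; 10; 13; 15]; Split 11 [::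
  Split 16 [::]; Split 17 [:: Split 12 [:: Split 14 [:: Cut [:: 1; 4; 5; 8; 11;
  13; 14; 15; 17]; Cut [:: 1; 2; 3; 10; 11; 12; 13; 14]]]]; Split 16 [::];
  Split 17 [:: Split 12 [:: Split 14 [:: Cut [:: 1; 2; 3; 10; 11; 12; 13; 14];
  Cut [:: 1; 4; 5; 9; 11; 13; 14; 15; 17]]]]]]; Split 14 [:: Cut [:: 0; 1; 2;
  3; 5; 7; 8; 14]; Cut [:: 0; 1; 2; 3; 5; 7; 9; 14]; Cut [:: 0; 1; 2; 4; 5; 6;
  7; 10; 14; 15]; Split 11 [:: Split 16 [::]; Split 17 [:: Split 12 [:: Split
  13 [:: Cut [:: 1; 4; 5; 8; 11; 13; 14; 15; 17]; Cut [:: 1; 2; 3; 10; 11; 12;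
  13; 14]]]]; Split 16 [::]; Split 17 [:: Split 12 [:: Split 13 [:: Cut [:: 1;
  2; 3; 10; 11; 12; 13; 14]; Cut [:: 1; 4; 5; 9; 11; 13; 14; 15; 17]]]]]];
  Split 11 [:: Split 8 [:: Cut [:: 0; 1; 2; 3; 4; 6; 8; 10; 11; 12]; Cut [:: 0;
  1; 3; 4; 5; 8; 11; 13]; Cut [:: 0; 1; 3; 4; 5; 8; 11; 14]]; Split 8 [:: Cut
  [:: 0; 1; 2; 3; 4; 6; 8; 10; 11; 12]; Cut [:: 0; 1; 3; 4; 5; 8; 11; 13]; Cut
  [:: 0; 1; 3; 4; 5; 8; 11; 14]]; Split 9 [:: Cut [:: 0; 1; 2; 3; 4; 6; 9; 10;
  11; 12]; Cut [:: 0; 1; 3; 4; 5; 9; 11; 13]; Cut [:: 0; 1; 3; 4; 5; 9; 11;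
  14]]; Split 9 [:: Cut [:: 0; 1; 2; 3; 4; 6; 9; 10; 11; 12]; Cut [:: 0; 1; 3;
  4; 5; 9; 11; 13]; Cut [:: 0; 1; 3; 4; 5; 9; 11; 14]]]]]]; Split 5 [:: Cut [::
  0; 1; 2; 4; 5; 6; 11; 12]; Split 11 [:: Cut [:: 0; 1; 2; 3; 4; 6; 8; 11]; Cut
  [:: 0; 1; 2; 3; 4; 6; 9; 11]; Split 7 [:: Cut [:: 0; 1; 2; 4; 5; 7; 10; 11;
  13]; Cut [:: 0; 1; 2; 4; 5; 7; 10; 11; 14]; Cut [:: 0; 1; 2; 4; 6; 7; 10;
  11]; Split 13 [:: Cut [:: 0; 1; 2; 3; 5; 7; 8; 13]; Cut [:: 0; 1; 2; 3; 5; 7;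
  9; 13]; Cut [:: 0; 1; 2; 4; 5; 6; 7; 11; 13; 15]; Split 10 [:: Split 16 [::];
  Split 17 [:: Split 12 [:: Split 14 [:: Cut [:: 1; 4; 5; 8; 10; 13; 14; 15;
  17]; Cut [:: 1; 2; 3; 10; 11; 12; 13; 14]]]]; Split 16 [::]; Split 17 [::
  Split 12 [:: Split 14 [:: Cut [:: 1; 2; 3; 10; 11; 12; 13; 14]; Cut [:: 1; 4;
  5; 9; 10; 13; 14; 15; 17]]]]]]; Split 14 [:: Cut [:: 0; 1; 2; 3; 5; 7; 8;
  14]; Cut [:: 0; 1; 2; 3; 5; 7; 9; 14]; Cut [:: 0; 1; 2; 4; 5; 6; 7; 11; 14;
  15]; Split 10 [:: Split 16 [::]; Split 17 [:: Split 12 [:: Split 13 [:: Cut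
  [:: 1; 4; 5; 8; 10; 13; 14; 15; 17]; Cut [:: 1; 2; 3; 10; 11; 12; 13; 14]]]];
  Split 16 [::]; Split 17 [:: Split 12 [:: Split 13 [:: Cut [:: 1; 2; 3; 10;
  11; 12; 13; 14]; Cut [:: 1; 4; 5; 9; 10; 13; 14; 15; 17]]]]]]; Split 10 [::
  Split 8 [:: Cut [:: 0; 1; 2; 3; 4; 6; 8; 10; 11; 12]; Cut [:: 0; 1; 3; 4; 5;
  8; 10; 13]; Cut [:: 0; 1; 3; 4; 5; 8; 10; 14]]; Split 8 [:: Cut [:: 0; 1; 2;
  3; 4; 6; 8; 10; 11; 12]; Cut [:: 0; 1; 3; 4; 5; 8; 10; 13]; Cut [:: 0; 1; 3;
  4; 5; 8; 10; 14]]; Split 9 [:: Cut [:: 0; 1; 2; 3; 4; 6; 9; 10; 11; 12]; Cut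
  [:: 0; 1; 3; 4; 5; 9; 10; 13]; Cut [:: 0; 1; 3; 4; 5; 9; 10; 14]]; Split 9
  [:: Cut [:: 0; 1; 2; 3; 4; 6; 9; 10; 11; 12]; Cut [:: 0; 1; 3; 4; 5; 9; 10;
  13]; Cut [:: 0; 1; 3; 4; 5; 9; 10; 14]]]]]]; Split 5 [:: Split 12 [:: Cut [::
  0; 1; 2; 3; 5; 6; 8; 12]; Cut [:: 0; 1; 2; 3; 5; 6; 9; 12]; Split 7 [:: Cut
  [:: 0; 1; 2; 4; 5; 7; 10; 12; 14]; Split 10 [:: Cut [:: 0; 1; 2; 3; 4; 7; 8;
  10]; Cut [:: 0; 1; 2; 3; 4; 7; 9; 10]; Cut [:: 0; 1; 2; 4; 5; 6; 7; 10; 12;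
  15]; Split 11 [:: Split 13 [::]; Split 15 [:: Split 16 [:: Split 13 [:: Cut
  [:: 1; 2; 3; 10; 11; 12; 13; 16]; Cut [:: 2; 6; 7; 9; 12; 13; 15; 16; 17]]]];
  Split 13 [::]; Split 15 [:: Split 16 [:: Split 13 [:: Cut [:: 2; 6; 7; 8; 12;
  13; 15; 16; 17]; Cut [:: 1; 2; 3; 10; 11; 12; 13; 16]]]]]]; Cut [:: 0; 1; 2;
  4; 5; 7; 11; 12; 14]; Split 11 [:: Cut [:: 0; 1; 2; 3; 4; 7; 8; 11]; Cut [::
  0; 1; 2; 3; 4; 7; 9; 11]; Cut [:: 0; 1; 2; 4; 5; 6; 7; 11; 12; 15]; Split 10
  [:: Split 13 [::]; Split 15 [:: Split 16 [:: Split 13 [:: Cut [:: 1; 2; 3;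
  10; 11; 12; 13; 16]; Cut [:: 2; 6; 7; 9; 12; 13; 15; 16; 17]]]]; Split 13
  [::]; Split 15 [:: Split 16 [:: Split 13 [:: Cut [:: 2; 6; 7; 8; 12; 13; 15;
  16; 17]; Cut [:: 1; 2; 3; 10; 11; 12; 13; 16]]]]]]; Cut [:: 0; 1; 2; 5; 6; 7;
  12; 14]; Split 13 [:: Split 8 [:: Cut [:: 0; 1; 2; 3; 5; 6; 8; 12; 13; 14];
  Cut [:: 0; 2; 3; 6; 7; 8; 13; 16]; Cut [:: 0; 2; 3; 6; 7; 8; 13; 17]]; Split
  8 [:: Cut [:: 0; 1; 2; 3; 5; 6; 8; 12; 13; 14]; Cut [:: 0; 2; 3; 6; 7; 8; 13;
  16]; Cut [:: 0; 2; 3; 6; 7; 8; 13; 17]]; Split 9 [:: Cut [:: 0; 1; 2; 3; 5;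
  6; 9; 12; 13; 14]; Cut [:: 0; 2; 3; 6; 7; 9; 13; 16]; Cut [:: 0; 2; 3; 6; 7;
  9; 13; 17]]; Split 9 [:: Cut [:: 0; 1; 2; 3; 5; 6; 9; 12; 13; 14]; Cut [:: 0;
  2; 3; 6; 7; 9; 13; 16]; Cut [:: 0; 2; 3; 6; 7; 9; 13; 17]]]]]; Split 13 [::
  Cut [:: 0; 1; 2; 3; 5; 6; 8; 13]; Cut [:: 0; 1; 2; 3; 5; 6; 9; 13]; Split 7
  [:: Cut [:: 0; 1; 2; 4; 5; 7; 10; 13; 14]; Split 10 [:: Cut [:: 0; 1; 2; 3;
  4; 7; 8; 10]; Cut [:: 0; 1; 2; 3; 4; 7; 9; 10]; Cut [:: 0; 1; 2; 4; 5; 6; 7;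
  10; 13; 15]; Split 11 [:: Split 12 [::]; Split 15 [:: Split 16 [:: Split 12
  [:: Cut [:: 1; 2; 3; 10; 11; 12; 13; 16]; Cut [:: 2; 6; 7; 9; 12; 13; 15; 16;
  17]]]]; Split 12 [::]; Split 15 [:: Split 16 [:: Split 12 [:: Cut [:: 2; 6;
  7; 8; 12; 13; 15; 16; 17]; Cut [:: 1; 2; 3; 10; 11; 12; 13; 16]]]]]]; Cut [::
  0; 1; 2; 4; 5; 7; 11; 13; 14]; Split 11 [:: Cut [:: 0; 1; 2; 3; 4; 7; 8; 11];
  Cut [:: 0; 1; 2; 3; 4; 7; 9; 11]; Cut [:: 0; 1; 2; 4; 5; 6; 7; 11; 13; 15];
  Split 10 [:: Split 12 [::]; Split 15 [:: Split 16 [:: Split 12 [:: Cut [:: 1;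
  2; 3; 10; 11; 12; 13; 16]; Cut [:: 2; 6; 7; 9; 12; 13; 15; 16; 17]]]]; Split
  12 [::]; Split 15 [:: Split 16 [:: Split 12 [:: Cut [:: 2; 6; 7; 8; 12; 13;
  15; 16; 17]; Cut [:: 1; 2; 3; 10; 11; 12; 13; 16]]]]]]; Cut [:: 0; 1; 2; 5;
  6; 7; 13; 14]; Split 12 [:: Split 8 [:: Cut [:: 0; 1; 2; 3; 5; 6; 8; 12; 13;
  14]; Cut [:: 0; 2; 3; 6; 7; 8; 12; 16]; Cut [:: 0; 2; 3; 6; 7; 8; 12; 17]];
  Split 8 [:: Cut [:: 0; 1; 2; 3; 5; 6; 8; 12; 13; 14]; Cut [:: 0; 2; 3; 6; 7;
  8; 12; 16]; Cut [:: 0; 2; 3; 6; 7; 8; 12; 17]]; Split 9 [:: Cut [:: 0; 1; 2;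
  3; 5; 6; 9; 12; 13; 14]; Cut [:: 0; 2; 3; 6; 7; 9; 12; 16]; Cut [:: 0; 2; 3;
  6; 7; 9; 12; 17]]; Split 9 [:: Cut [:: 0; 1; 2; 3; 5; 6; 9; 12; 13; 14]; Cut
  [:: 0; 2; 3; 6; 7; 9; 12; 16]; Cut [:: 0; 2; 3; 6; 7; 9; 12; 17]]]]]; Split 7
  [:: Cut [:: 0; 1; 2; 4; 5; 7; 10; 14]; Cut [:: 0; 1; 2; 4; 5; 7; 10; 15];
  Split 10 [:: Cut [:: 0; 1; 2; 3; 4; 7; 8; 10]; Cut [:: 0; 1; 2; 3; 4; 7; 9;
  10]; Split 11 [:: Split 8 [:: Cut [:: 0; 1; 3; 4; 5; 8; 11; 14]; Cut [:: 0;
  1; 3; 4; 5; 8; 11; 15]; Cut [:: 0; 1; 2; 3; 4; 7; 8; 10; 11; 16]]; Split 8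
  [:: Cut [:: 0; 1; 3; 4; 5; 8; 11; 14]; Cut [:: 0; 1; 3; 4; 5; 8; 11; 15]; Cut
  [:: 0; 1; 2; 3; 4; 7; 8; 10; 11; 16]]; Split 9 [:: Cut [:: 0; 1; 3; 4; 5; 9;
  11; 14]; Cut [:: 0; 1; 3; 4; 5; 9; 11; 15]; Cut [:: 0; 1; 2; 3; 4; 7; 9; 10;
  11; 16]]; Split 9 [:: Cut [:: 0; 1; 3; 4; 5; 9; 11; 14]; Cut [:: 0; 1; 3; 4;
  5; 9; 11; 15]; Cut [:: 0; 1; 2; 3; 4; 7; 9; 10; 11; 16]]]]; Cut [:: 0; 1; 2;
  4; 5; 7; 11; 14]; Cut [:: 0; 1; 2; 4; 5; 7; 11; 15]; Split 11 [:: Cut [:: 0;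
  1; 2; 3; 4; 7; 8; 11]; Cut [:: 0; 1; 2; 3; 4; 7; 9; 11]; Split 10 [:: Split 8
  [:: Cut [:: 0; 1; 3; 4; 5; 8; 10; 14]; Cut [:: 0; 1; 3; 4; 5; 8; 10; 15]; Cut
  [:: 0; 1; 2; 3; 4; 7; 8; 10; 11; 16]]; Split 8 [:: Cut [:: 0; 1; 3; 4; 5; 8;
  10; 14]; Cut [:: 0; 1; 3; 4; 5; 8; 10; 15]; Cut [:: 0; 1; 2; 3; 4; 7; 8; 10;
  11; 16]]; Split 9 [:: Cut [:: 0; 1; 3; 4; 5; 9; 10; 14]; Cut [:: 0; 1; 3; 4;
  5; 9; 10; 15]; Cut [:: 0; 1; 2; 3; 4; 7; 9; 10; 11; 16]]; Split 9 [:: Cut [::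
  0; 1; 3; 4; 5; 9; 10; 14]; Cut [:: 0; 1; 3; 4; 5; 9; 10; 15]; Cut [:: 0; 1;
  2; 3; 4; 7; 9; 10; 11; 16]]]]; Split 14 [:: Cut [:: 0; 1; 2; 3; 5; 7; 8; 14];
  Cut [:: 0; 1; 2; 3; 5; 7; 9; 14]; Split 15 [:: Split 8 [:: Cut [:: 0; 1; 3;
  4; 5; 8; 10; 15]; Cut [:: 0; 1; 3; 4; 5; 8; 11; 15]; Cut [:: 0; 1; 2; 3; 5;
  7; 8; 14; 15; 16]]; Split 8 [:: Cut [:: 0; 1; 3; 4; 5; 8; 10; 15]; Cut [:: 0;
  1; 3; 4; 5; 8; 11; 15]; Cut [:: 0; 1; 2; 3; 5; 7; 8; 14; 15; 16]]; Split 9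
  [:: Cut [:: 0; 1; 3; 4; 5; 9; 10; 15]; Cut [:: 0; 1; 3; 4; 5; 9; 11; 15]; Cut
  [:: 0; 1; 2; 3; 5; 7; 9; 14; 15; 16]]; Split 9 [:: Cut [:: 0; 1; 3; 4; 5; 9;
  10; 15]; Cut [:: 0; 1; 3; 4; 5; 9; 11; 15]; Cut [:: 0; 1; 2; 3; 5; 7; 9; 14;
  15; 16]]]]; Split 15 [:: Cut [:: 0; 1; 2; 3; 5; 7; 8; 15]; Cut [:: 0; 1; 2;
  3; 5; 7; 9; 15]; Split 14 [:: Split 8 [:: Cut [:: 0; 1; 3; 4; 5; 8; 10; 14];
  Cut [:: 0; 1; 3; 4; 5; 8; 11; 14]; Cut [:: 0; 1; 2; 3; 5; 7; 8; 14; 15; 16]];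
  Split 8 [:: Cut [:: 0; 1; 3; 4; 5; 8; 10; 14]; Cut [:: 0; 1; 3; 4; 5; 8; 11;
  14]; Cut [:: 0; 1; 2; 3; 5; 7; 8; 14; 15; 16]]; Split 9 [:: Cut [:: 0; 1; 3;
  4; 5; 9; 10; 14]; Cut [:: 0; 1; 3; 4; 5; 9; 11; 14]; Cut [:: 0; 1; 2; 3; 5;
  7; 9; 14; 15; 16]]; Split 9 [:: Cut [:: 0; 1; 3; 4; 5; 9; 10; 14]; Cut [:: 0;
  1; 3; 4; 5; 9; 11; 14]; Cut [:: 0; 1; 2; 3; 5; 7; 9; 14; 15; 16]]]]; Split 10
  [:: Split 12 [:: Split 13 [:: Split 9 [:: Split 8 [:: Split 16 [::]; Split 17
  [::]]; Cut [:: 0; 2; 3; 6; 7; 9; 13; 16]; Cut [:: 0; 2; 3; 6; 7; 9; 13; 17]];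
  Split 11 [:: Cut [:: 0; 1; 3; 4; 8; 9; 10; 11]; Cut [:: 0; 1; 3; 4; 8; 9; 10;
  11]]; Cut [:: 1; 4; 5; 6; 10; 11; 12; 13; 14; 15]]; Split 13 [:: Split 9 [::
  Split 8 [:: Split 16 [::]; Split 17 [::]]; Cut [:: 0; 2; 3; 6; 7; 9; 13; 16];
  Cut [:: 0; 2; 3; 6; 7; 9; 13; 17]]; Split 11 [:: Cut [:: 0; 1; 3; 4; 8; 9;
  10; 11]; Cut [:: 0; 1; 3; 4; 8; 9; 10; 11]]; Cut [:: 1; 4; 5; 6; 10; 11; 12;
  13; 14; 15]]]; Split 13 [:: Split 12 [:: Split 9 [:: Split 8 [:: Split 16
  [::]; Split 17 [::]]; Cut [:: 0; 2; 3; 6; 7; 9; 12; 16]; Cut [:: 0; 2; 3; 6;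
  7; 9; 12; 17]]; Split 11 [:: Cut [:: 0; 1; 3; 4; 8; 9; 10; 11]; Cut [:: 0; 1;
  3; 4; 8; 9; 10; 11]]; Cut [:: 1; 4; 5; 6; 10; 11; 12; 13; 14; 15]]; Split 12
  [:: Split 9 [:: Split 8 [:: Split 16 [::]; Split 17 [::]]; Cut [:: 0; 2; 3;
  6; 7; 9; 12; 16]; Cut [:: 0; 2; 3; 6; 7; 9; 12; 17]]; Split 11 [:: Cut [:: 0;
  1; 3; 4; 8; 9; 10; 11]; Cut [:: 0; 1; 3; 4; 8; 9; 10; 11]]; Cut [:: 1; 4; 5;
  6; 10; 11; 12; 13; 14; 15]]]; Split 16 [:: Split 17 [:: Split 9 [:: Cut [::
  0; 2; 3; 6; 7; 9; 12; 17]; Cut [:: 0; 2; 3; 6; 7; 9; 13; 17]; Split 8 [::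
  Split 12 [::]; Split 13 [::]]]; Split 11 [:: Cut [:: 0; 1; 3; 4; 8; 9; 10;
  11]; Cut [:: 0; 1; 3; 4; 8; 9; 10; 11]]; Cut [:: 1; 4; 5; 7; 10; 11; 14; 15;
  16; 17]]; Split 17 [:: Split 9 [:: Cut [:: 0; 2; 3; 6; 7; 9; 12; 17]; Cut [::
  0; 2; 3; 6; 7; 9; 13; 17]; Split 8 [:: Split 12 [::]; Split 13 [::]]]; Split
  11 [:: Cut [:: 0; 1; 3; 4; 8; 9; 10; 11]; Cut [:: 0; 1; 3; 4; 8; 9; 10; 11]];
  Cut [:: 1; 4; 5; 7; 10; 11; 14; 15; 16; 17]]]; Split 17 [:: Split 16 [::
  Split 9 [:: Cut [:: 0; 2; 3; 6; 7; 9; 12; 16]; Cut [:: 0; 2; 3; 6; 7; 9; 13;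
  16]; Split 8 [:: Split 12 [::]; Split 13 [::]]]; Split 11 [:: Cut [:: 0; 1;
  3; 4; 8; 9; 10; 11]; Cut [:: 0; 1; 3; 4; 8; 9; 10; 11]]; Cut [:: 1; 4; 5; 7;
  10; 11; 14; 15; 16; 17]]; Split 16 [:: Split 9 [:: Cut [:: 0; 2; 3; 6; 7; 9;
  12; 16]; Cut [:: 0; 2; 3; 6; 7; 9; 13; 16]; Split 8 [:: Split 12 [::]; Split
  13 [::]]]; Split 11 [:: Cut [:: 0; 1; 3; 4; 8; 9; 10; 11]; Cut [:: 0; 1; 3;
  4; 8; 9; 10; 11]]; Cut [:: 1; 4; 5; 7; 10; 11; 14; 15; 16; 17]]]; Split 12
  [:: Split 13 [:: Split 8 [:: Split 9 [:: Split 16 [::]; Split 17 [::]]; Cut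
  [:: 0; 2; 3; 6; 7; 8; 13; 16]; Cut [:: 0; 2; 3; 6; 7; 8; 13; 17]]; Split 11
  [:: Cut [:: 0; 1; 3; 4; 8; 9; 10; 11]; Cut [:: 0; 1; 3; 4; 8; 9; 10; 11]];
  Cut [:: 1; 4; 5; 6; 10; 11; 12; 13; 14; 15]]; Split 13 [:: Split 8 [:: Split
  9 [:: Split 16 [::]; Split 17 [::]]; Cut [:: 0; 2; 3; 6; 7; 8; 13; 16]; Cut
  [:: 0; 2; 3; 6; 7; 8; 13; 17]]; Split 11 [:: Cut [:: 0; 1; 3; 4; 8; 9; 10;
  11]; Cut [:: 0; 1; 3; 4; 8; 9; 10; 11]]; Cut [:: 1; 4; 5; 6; 10; 11; 12; 13;
  14; 15]]]; Split 13 [:: Split 12 [:: Split 8 [:: Split 9 [:: Split 16 [::];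
  Split 17 [::]]; Cut [:: 0; 2; 3; 6; 7; 8; 12; 16]; Cut [:: 0; 2; 3; 6; 7; 8;
  12; 17]]; Split 11 [:: Cut [:: 0; 1; 3; 4; 8; 9; 10; 11]; Cut [:: 0; 1; 3; 4;
  8; 9; 10; 11]]; Cut [:: 1; 4; 5; 6; 10; 11; 12; 13; 14; 15]]; Split 12 [::
  Split 8 [:: Split 9 [:: Split 16 [::]; Split 17 [::]]; Cut [:: 0; 2; 3; 6; 7;
  8; 12; 16]; Cut [:: 0; 2; 3; 6; 7; 8; 12; 17]]; Split 11 [:: Cut [:: 0; 1; 3;
  4; 8; 9; 10; 11]; Cut [:: 0; 1; 3; 4; 8; 9; 10; 11]]; Cut [:: 1; 4; 5; 6; 10;
  11; 12; 13; 14; 15]]]; Split 16 [:: Split 17 [:: Split 8 [:: Cut [:: 0; 2; 3;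
  6; 7; 8; 12; 17]; Cut [:: 0; 2; 3; 6; 7; 8; 13; 17]; Split 9 [:: Split 12
  [::]; Split 13 [::]]]; Split 11 [:: Cut [:: 0; 1; 3; 4; 8; 9; 10; 11]; Cut
  [:: 0; 1; 3; 4; 8; 9; 10; 11]]; Cut [:: 1; 4; 5; 7; 10; 11; 14; 15; 16; 17]];
  Split 17 [:: Split 8 [:: Cut [:: 0; 2; 3; 6; 7; 8; 12; 17]; Cut [:: 0; 2; 3;
  6; 7; 8; 13; 17]; Split 9 [:: Split 12 [::]; Split 13 [::]]]; Split 11 [::
  Cut [:: 0; 1; 3; 4; 8; 9; 10; 11]; Cut [:: 0; 1; 3; 4; 8; 9; 10; 11]]; Cut
  [:: 1; 4; 5; 7; 10; 11; 14; 15; 16; 17]]]; Split 17 [:: Split 16 [:: Split 8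
  [:: Cut [:: 0; 2; 3; 6; 7; 8; 12; 16]; Cut [:: 0; 2; 3; 6; 7; 8; 13; 16];
  Split 9 [:: Split 12 [::]; Split 13 [::]]]; Split 11 [:: Cut [:: 0; 1; 3; 4;
  8; 9; 10; 11]; Cut [:: 0; 1; 3; 4; 8; 9; 10; 11]]; Cut [:: 1; 4; 5; 7; 10;
  11; 14; 15; 16; 17]]; Split 16 [:: Split 8 [:: Cut [:: 0; 2; 3; 6; 7; 8; 12;
  16]; Cut [:: 0; 2; 3; 6; 7; 8; 13; 16]; Split 9 [:: Split 12 [::]; Split 13
  [::]]]; Split 11 [:: Cut [:: 0; 1; 3; 4; 8; 9; 10; 11]; Cut [:: 0; 1; 3; 4;
  8; 9; 10; 11]]; Cut [:: 1; 4; 5; 7; 10; 11; 14; 15; 16; 17]]]; Split 11 [::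
  Split 8 [:: Cut [:: 0; 1; 3; 4; 5; 8; 11; 14]; Cut [:: 0; 1; 3; 4; 5; 8; 11;
  15]; Split 16 [:: Cut [:: 0; 2; 3; 7; 8; 9; 16; 17]; Split 9 [:: Split 15
  [::]]; Split 9 [:: Split 14 [::]]]]; Split 8 [:: Split 12 [:: Cut [:: 0; 2;
  3; 6; 8; 9; 12; 13]; Split 9 [:: Split 13 [::]]; Split 9 [:: Split 13 [::]]];
  Cut [:: 0; 1; 3; 4; 5; 8; 11; 14]; Cut [:: 0; 1; 3; 4; 5; 8; 11; 15]]; Split
  9 [:: Cut [:: 0; 1; 3; 4; 5; 9; 11; 14]; Cut [:: 0; 1; 3; 4; 5; 9; 11; 15];
  Split 16 [:: Cut [:: 0; 2; 3; 7; 8; 9; 16; 17]; Split 8 [:: Split 15 [::]];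
  Split 8 [:: Split 14 [::]]]]; Split 9 [:: Split 12 [:: Cut [:: 0; 2; 3; 6; 8;
  9; 12; 13]; Split 8 [:: Split 13 [::]]; Split 8 [:: Split 13 [::]]]; Cut [::
  0; 1; 3; 4; 5; 9; 11; 14]; Cut [:: 0; 1; 3; 4; 5; 9; 11; 15]]; Cut [:: 2; 4;
  6; 7; 10; 11; 12; 13; 16; 17]]; Split 11 [:: Split 8 [:: Cut [:: 0; 1; 3; 4;
  5; 8; 11; 14]; Cut [:: 0; 1; 3; 4; 5; 8; 11; 15]; Split 17 [:: Cut [:: 0; 2;
  3; 7; 8; 9; 16; 17]; Split 9 [:: Split 15 [::]]; Split 9 [:: Split 14
  [::]]]]; Split 8 [:: Split 12 [:: Cut [:: 0; 2; 3; 6; 8; 9; 12; 13]; Split 9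
  [:: Split 13 [::]]; Split 9 [:: Split 13 [::]]]; Cut [:: 0; 1; 3; 4; 5; 8;
  11; 14]; Cut [:: 0; 1; 3; 4; 5; 8; 11; 15]]; Split 9 [:: Cut [:: 0; 1; 3; 4;
  5; 9; 11; 14]; Cut [:: 0; 1; 3; 4; 5; 9; 11; 15]; Split 17 [:: Cut [:: 0; 2;
  3; 7; 8; 9; 16; 17]; Split 8 [:: Split 15 [::]]; Split 8 [:: Split 14
  [::]]]]; Split 9 [:: Split 12 [:: Cut [:: 0; 2; 3; 6; 8; 9; 12; 13]; Split 8
  [:: Split 13 [::]]; Split 8 [:: Split 13 [::]]]; Cut [:: 0; 1; 3; 4; 5; 9;
  11; 14]; Cut [:: 0; 1; 3; 4; 5; 9; 11; 15]]; Cut [:: 2; 4; 6; 7; 10; 11; 12;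
  13; 16; 17]]; Split 11 [:: Split 8 [:: Cut [:: 0; 1; 3; 4; 5; 8; 11; 14]; Cut
  [:: 0; 1; 3; 4; 5; 8; 11; 15]; Split 16 [:: Cut [:: 0; 2; 3; 7; 8; 9; 16;
  17]; Split 9 [:: Split 15 [::]]; Split 9 [:: Split 14 [::]]]]; Split 8 [::
  Split 13 [:: Cut [:: 0; 2; 3; 6; 8; 9; 12; 13]; Split 9 [:: Split 12 [::]];
  Split 9 [:: Split 12 [::]]]; Cut [:: 0; 1; 3; 4; 5; 8; 11; 14]; Cut [:: 0; 1;
  3; 4; 5; 8; 11; 15]]; Split 9 [:: Cut [:: 0; 1; 3; 4; 5; 9; 11; 14]; Cut [::
  0; 1; 3; 4; 5; 9; 11; 15]; Split 16 [:: Cut [:: 0; 2; 3; 7; 8; 9; 16; 17];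
  Split 8 [:: Split 15 [::]]; Split 8 [:: Split 14 [::]]]]; Split 9 [:: Split
  13 [:: Cut [:: 0; 2; 3; 6; 8; 9; 12; 13]; Split 8 [:: Split 12 [::]]; Split 8
  [:: Split 12 [::]]]; Cut [:: 0; 1; 3; 4; 5; 9; 11; 14]; Cut [:: 0; 1; 3; 4;
  5; 9; 11; 15]]; Cut [:: 2; 4; 6; 7; 10; 11; 12; 13; 16; 17]]; Split 11 [::
  Split 8 [:: Cut [:: 0; 1; 3; 4; 5; 8; 11; 14]; Cut [:: 0; 1; 3; 4; 5; 8; 11;
  15]; Split 17 [:: Cut [:: 0; 2; 3; 7; 8; 9; 16; 17]; Split 9 [:: Split 15
  [::]]; Split 9 [:: Split 14 [::]]]]; Split 8 [:: Split 13 [:: Cut [:: 0; 2;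
  3; 6; 8; 9; 12; 13]; Split 9 [:: Split 12 [::]]; Split 9 [:: Split 12 [::]]];
  Cut [:: 0; 1; 3; 4; 5; 8; 11; 14]; Cut [:: 0; 1; 3; 4; 5; 8; 11; 15]]; Split
  9 [:: Cut [:: 0; 1; 3; 4; 5; 9; 11; 14]; Cut [:: 0; 1; 3; 4; 5; 9; 11; 15];
  Split 17 [:: Cut [:: 0; 2; 3; 7; 8; 9; 16; 17]; Split 8 [:: Split 15 [::]];
  Split 8 [:: Split 14 [::]]]]; Split 9 [:: Split 13 [:: Cut [:: 0; 2; 3; 6; 8;
  9; 12; 13]; Split 8 [:: Split 12 [::]]; Split 8 [:: Split 12 [::]]]; Cut [::
  0; 1; 3; 4; 5; 9; 11; 14]; Cut [:: 0; 1; 3; 4; 5; 9; 11; 15]]; Cut [:: 2; 4;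
  6; 7; 10; 11; 12; 13; 16; 17]]]]]]]]]]].

Definition pentagon_rows : seq bitseq :=
  [:: [:: false; true; false; false; true]; [:: true; false; true];
      [:: false; true; false; true]; [:: false; false; true; false; true];
      [:: true; false; false; true]].

(** In a loopless graph without triangles a closed walk of length 5 has five distinct vertices: two
    equal ones would be joined by a walk of length 1 or 3. *)
Lemma embeds_pentagon (V : finType) (x0 : V) (e : rel V) (a b c f g : V) :
    symmetric e -> irreflexive e ->
    (forall x y z, e x y -> e y z -> ~~ e z x) ->
    e a b -> e b c -> e c f -> e f g -> e g a ->
  embeds x0 e [:: a; b; c; f; g] pentagon_rows.
Proof.
move=> e_sym e_irr tri ab bc cf fg ga.
have adj x y : e x y -> x != y by move=> xy; apply: contraTneq xy => ->; rewrite e_irr.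
have dist2 x y z w : e x y -> e y z -> e z w -> x != w.
  by move=> xy yz zw; apply: contraTneq zw => <-; exact: tri yz.
split=> //.
  rewrite /= !inE !negb_or (adj _ _ ab) (adj _ _ bc) (adj _ _ cf) (adj _ _ fg).
  rewrite (eq_sym a g) (adj _ _ ga) (eq_sym a f) (eq_sym b g).
  rewrite (eq_sym a c) (eq_sym b f) (eq_sym c g).
  by rewrite (dist2 c f g a) // (dist2 f g a b) // (dist2 g a b c) //
    (eq_sym f a) (dist2 a b c f) // (eq_sym g b) (dist2 b c f g).
move=> i j; case: i => [|[|[|[|[|i]]]]]; case: j => [|[|[|[|[|j]]]]] //=;
  by rewrite /edge /row /= ?nth_nil // ?[e g f]e_sym ?[e b a]e_sym ?[e c b]e_sym
    ?[e f c]e_sym ?[e a g]e_sym.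
Qed.

Lemma embeds_point (V : finType) (x0 : V) (e : rel V) (x : V) :
  embeds x0 e [:: x] [:: [::]].
Proof.
by split=> // i j; rewrite /edge /row; case: i => [|[|i]]; rewrite /= ?nth_nil.
Qed.

Lemma refutation_nonexistence (r : nat) (c c5 : refutation) : 0 < r ->
    let v := 2 * r + 4 in let d := r - 3 in let B := (v * r) %/ 3 - v in
    refutes v d B true [:: [::]] c -> refutes v d B false pentagon_rows c5 ->
  ~ exists_pent_with_best_code 3 r.
Proof.
move=> r_gt0 v d B ok ok5 [T [L [geom [S [_ code _]]]]].
set e := deficiency_graph L.
have cardT : #|T| = v := pent_card geom r_gt0.
have few (W : {set T}) :
    2 * d * #|W| <= \sum_(x in W) #|[set y in W | far e x y]| + 2 * B.
  have := few_far_pairs geom r_gt0 code W.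
  have := card_far_lines geom code; rewrite cardT => cF.
  (* By the count of flags, [v * r] is three times the sum of [v] and the number of far lines, so
     the division and the subtraction in [B] are exact. *)
  rewrite (_ : B = #|far_lines L|) //.
  by rewrite /B -cF mulKn // addnK.
have [x0 _] : exists x : T, x \in T by apply/card_gt0P; exact: pent_nonempty geom.
have sym := @deficiency_sym _ L; have irr := deficiency_irr geom r_gt0.
have cub := deficiency_cubic geom; have tri := deficiency_no_triangle geom.
have sqr := deficiency_no_square geom code.
case: (boolP [exists a, exists b, exists c', exists f, exists g,
   [&& e a b, e b c', e c' f, e f g & e g a]]) => [|nopent].
  case/existsP => a /existsP[b /existsP[c' /existsP[f /existsP[g]]]].
  case/and5P => ab bc cf fg ga.
  apply/negP: ok5; apply: (refutes_sound sym irr cub tri sqr _ cardT few) => //.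
  exact: (embeds_pentagon x0 sym irr tri ab bc cf fg ga).
apply/negP: ok; apply: (refutes_sound sym irr cub tri sqr _ cardT few) => //.
  move=> _ a b c' f g ab bc cf fg; apply: contra nopent => ga.
  apply/existsP; exists a; apply/existsP; exists b; apply/existsP; exists c'.
  by apply/existsP; exists f; apply/existsP; exists g; apply/and5P.
exact: (embeds_point x0).
Qed.

Lemma no_pent3 (r : nat) :
  r \in [:: 1; 4; 6; 7] -> ~ exists_pent_with_best_code 3 r.
Proof.
rewrite !inE => /or4P[] /eqP ->.
- by apply: (@refutation_nonexistence _ refutation6 refutation6_pentagon) => //;
    vm_compute.
- by apply: (@refutation_nonexistence _ refutation12 refutation12_pentagon) => //;
    vm_compute.
- by apply: (@refutation_nonexistence _ refutation16 refutation16_pentagon) => //;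
    vm_compute.
- by apply: (@refutation_nonexistence _ refutation18 refutation18_pentagon) => //;
    vm_compute.
Qed.

Theorem theorem6p3 :
  (forall r : nat, 0 < r -> r %% 3 = 0 \/ r %% 3 = 1 ->
     r \notin [:: 1; 4; 6; 7] -> exists_pent_with_best_code 3 r) /\
  (forall r : nat, r \in [:: 1; 4; 6; 7] -> ~ exists_pent_with_best_code 3 r).
Proof. by split; [exact: exists_pent3 | exact: no_pent3]. Qed.
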